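(* Let $\sigma,\tau,\bar\sigma,\bar\tau$ satisfy the Standing Hypothesis. (i) If $a\ge b\ge2$ are integers, then $$\{\sigma,a,b,\tau\,|\,\bar\sigma,1,\bar\tau\}-\{\sigma,a+1,b-1,\tau\,|\,\bar\sigma,1,\bar\tau\}$$ is Schur positive. (ii) If $a\ge2$ and $n\ge2$ are integers, then $$\{\sigma,a^n,\tau\,|\,\bar\sigma,1^{n-1},\bar\tau\}-\{\sigma,a+1,a^{n-2},a-1,\tau\,|\,\bar\sigma,1^{n-1},\bar\tau\}$$ is Schur positive.
   Context: A symmetric function is Schur positive if it is a linear combination of Schur functions $s_\nu$ with non-negative coefficients. Overlap notation: for $\alpha=(\alpha_1,\dots,\alpha_L)$ with $\alpha_i\ge1$ and $\beta=(\beta_1,\dots,\beta_{L-1})$ with $0\le\beta_i\le\min\{\alpha_i,\alpha_{i+1}\}$, $(\alpha\,|\,\beta)$ is the skew diagram $\lambda/\mu$ (boxes $(i,j)$ with $\mu_i<j\le\lambda_i$, identified up to deleting empty rows/columns) with $L$ nonempty rows, $\lambda_i-\mu_i=\alpha_i$, $\lambda_{i+1}-\mu_i=\beta_i$ (row $i$ has $\alpha_i$ boxes, rows $i,i+1$ share $\beta_i$ columns); $\{\alpha\,|\,\beta\}=s_{\lambda/\mu}$ is its skew Schur function (generating function of semistandard Young tableaux of that shape). Commas denote concatenation of sequences; $a^j$ denotes $j$ copies of $a$ (empty if $j=0$). Standing Hypothesis: $\sigma=(\sigma_1,\dots,\sigma_s)$, $\tau=(\tau_1,\dots,\tau_t)$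 compositions, $s,t\ge0$; $\bar\sigma,\bar\tau$ sequences of non-negative integers of lengths $s,t$; $\bar\sigma_s=1$ if $s>0$; $\bar\tau_1=1$ if $t>0$; $\bar\sigma_i\le\min\{\sigma_i,\sigma_{i+1}\}$ ($1\le i<s$), $\bar\tau_i\le\min\{\tau_i,\tau_{i-1}\}$ ($1<i\le t$). *)

(* Defs.v *)
From HB Require Import structures.
From mathcomp Require Import all_boot all_order all_algebra.
Set Implicit Arguments. Unset Strict Implicit. Unset Printing Implicit Defensive.
Import Order.TTheory GRing.Theory Num.Theory.

(* ---------- Skew shapes ----------
   A skew shape lambda/mu is a pair (lam, mu) of sequences of equal length;
   row i (0-indexed, English notation, top row first) consists of the cells
   (i, j) with mu_i <= j < lam_i (0-indexed columns). *)

(* Overlap notation (alpha | beta): L = size alpha rows, row i has alpha_i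
   boxes, rows i, i+1 share beta_i columns.  Normalised so that the bottom row
   starts in column 0:  mu_{L-1} = 0,  mu_i = lam_{i+1} - beta_i,
   lam_i = mu_i + alpha_i, i.e. mu_i = sum_{k > i} (alpha_k - beta_{k-1}). *)
Definition ov_mu (al be : seq nat) (i : nat) : nat :=
  sumn [seq nth 0 al k - nth 0 be k.-1 | k <- iota i.+1 (size al - i.+1)].
Definition ov_lam (al be : seq nat) (i : nat) : nat := ov_mu al be i + nth 0 al i.
Definition overlap_shape (al be : seq nat) : seq nat * seq nat :=
  (mkseq (ov_lam al be) (size al), mkseq (ov_mu al be) (size al)).

Definition row_lengths (sh : seq nat * seq nat) : seq nat :=
  [seq nth 0 sh.1 i - nth 0 sh.2 i | i <- iota 0 (size sh.1)].

Fixpoint words (m k : nat) : seq (seq nat) :=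
  if k is k'.+1 then [seq x :: w | x <- iota 0 m, w <- words m k'] else [:: [::]].

Fixpoint fillings (m : nat) (ls : seq nat) : seq (seq (seq nat)) :=
  if ls is l :: ls' then [seq r :: T | r <- words m l, T <- fillings m ls']
  else [:: [::]].

Definition is_ssyt (sh : seq nat * seq nat) (T : seq (seq nat)) : bool :=
  let lam := sh.1 in let mu := sh.2 in
  [&& size T == size lam,
      all (fun i => size (nth [::] T i) == nth 0 lam i - nth 0 mu i) (iota 0 (size lam)),
      all (sorted leq) T &
      all (fun i =>
        all (fun j =>
          ((nth 0 mu i <= j < nth 0 lam i) && (nth 0 mu i.+1 <= j < nth 0 lam i.+1)) ==>
          (nth 0 (nth [::] T i) (j - nth 0 mu i) <
           nth 0 (nth [::] T i.+1) (j - nth 0 mu i.+1)))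
          (iota 0 (nth 0 lam i)))
        (iota 0 (size lam).-1)].

(* content of a filling over the alphabet {0,...,m-1} (letter k stands for k+1) *)
Definition content (m : nat) (T : seq (seq nat)) : seq nat :=
  [seq count_mem k (flatten T) | k <- iota 0 m].

(* A symmetric function f is represented by its coefficients: for a monomial
   exponent vector al (of any length m), f al is the coefficient of
   x_1^{al_1} ... x_m^{al_m} in f(x_1,...,x_m,0,0,...). *)
Definition symfun := seq nat -> rat.

Definition skew_schur (sh : seq nat * seq nat) : symfun := fun al =>
  (count (fun T => is_ssyt sh T && (content (size al) T == al))
         (fillings (size al) (row_lengths sh)))%:R%R.

Definition ov_schur (al be : seq nat) : symfun := skew_schur (overlap_shape al be).

Definition is_partition (nu : seq nat) : bool := sorted geq nu && all (fun x => 0 < x) nu.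

Definition schur (nu : seq nat) : symfun := skew_schur (nu, nseq (size nu) 0).

Definition schur_positive (f : symfun) : Prop :=
  exists cs : seq (seq nat * rat),
    all (fun p => is_partition p.1 && (0 <= p.2)%R) cs /\
    forall al : seq nat, f al = (\sum_(p <- cs) p.2 * schur p.1 al)%R.

Definition standing_hyp (sigma tau sb tb : seq nat) : Prop :=
  all (fun x => 0 < x) sigma /\ all (fun x => 0 < x) tau /\
  size sb = size sigma /\ size tb = size tau /\
  (0 < size sigma -> nth 0 sb (size sigma).-1 = 1) /\
  (0 < size tau -> nth 0 tb 0 = 1) /\
  (forall i, i.+1 < size sigma ->
      nth 0 sb i <= minn (nth 0 sigma i) (nth 0 sigma i.+1)) /\
  (forall i, 0 < i < size tau ->
      nth 0 tb i <= minn (nth 0 tau i) (nth 0 tau i.-1)).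

(* Main.v *)
Require Import Defs.
From HB Require Import structures.
From mathcomp Require Import all_boot all_order all_algebra.
From mathcomp Require Import all_fingroup mpoly zify ring.
Set Implicit Arguments. Unset Strict Implicit. Unset Printing Implicit Defensive.
Import GRing.Theory.

(* Write S_u = {sigma, u}, T_v = {v, tau}, J_n = {sigma, n, tau}, with overlaps 1
   next to the new rows, and h_k for a single row. Exchanging the tails of two
   adjacent rows at the first failure of their overlap condition shows
     {sigma, u, v, tau | .., o, ..} = S_u T_v - J_{u+v-o+1} h_{o-1},        (D)
   the case o = 1 being the product rule. By the product rule and (D),
   J_u h_v - S_u T_v is the skew shape obtained from (sigma, u, tau) by gluing a row
   of length v to the right of the first row of tau, with overlap v + 1 (and it is 0
   if tau is empty). Hence
     S_a T_b - S_{a+1} T_{b-1}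
       = (S_a T_b - J_{a+1} h_{b-1}) + (J_{a+1} h_{b-1} - S_{a+1} T_{b-1})
   is a sum of two skew Schur functions, which is (i).

   For (ii), move the row a - 1 up to the second place, one row at a time.
   Exchanging neighbours u, v changes the function by S_u T_v - S_v T_u in the
   current context, and the sum of these changes telescopes into boundary terms
   plus the analogous sum with (u, v) replaced by (a + v, u) and one row fewer.
   Two such steps lead from (c, c - 1) to (a + c, a + c - 1), and what remains
   at each stage consists of expressions of the two positive kinds above.

   Skew Schur functions are Schur positive by Stembridge's argument: in
     a_delta s_{lam/mu} = sum_T a_{delta + wt T}
   the tableaux that are not Yamanouchi cancel under a Bender-Knuth involution
   restricted to the columns left of the rightmost unbalanced one. *)

(** * Rows and tail exchange *)

Section BigSeq.
Local Open Scope ring_scope.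
Variable R : nmodType.

Lemma big_seq_bij (I J : eqType) (s : seq I) (t : seq J) (f : I -> J) (g : J -> I)
    (F : I -> R) (G : J -> R) :
  uniq s -> uniq t ->
  (forall x, x \in s -> [/\ f x \in t, g (f x) = x & F x = G (f x)]) ->
  (forall y, y \in t -> g y \in s /\ f (g y) = y) ->
  \sum_(x <- s) F x = \sum_(y <- t) G y.
Proof.
move=> us ut fP gP.
have pst : perm_eq (map f s) t.
  apply: uniq_perm => //.
    rewrite map_inj_in_uniq // => x y xs ys e.
    by have [_ <- _] := fP _ xs; have [_ <- _] := fP _ ys; rewrite e.
  move=> y; apply/mapP/idP => [[x xs ->]|yt]; first by have [] := fP _ xs.
  by have [gs e] := gP _ yt; exists (g y).
rewrite -(perm_big _ pst) big_map /= big_seq_cond [RHS]big_seq_cond.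
by apply: eq_bigr => x; rewrite andbT => /fP[].
Qed.
End BigSeq.

Definition rows (m k : nat) : seq (seq nat) := [seq r <- words m k | sorted leq r].

Lemma mem_words m k r : (r \in words m k) = (size r == k) && all (fun x => x < m) r.
Proof.
elim: k r => [|k IH] r /=; first by rewrite inE; case: r.
apply/allpairsP/idP => [[[x w] [/=]]|].
  by rewrite mem_iota add0n IH => /andP[_ xm] /andP[/eqP <- aw] -> /=; rewrite eqxx xm.
case: r => [|x w] //= /and3P[/eqP[sw] xm aw]; exists (x, w).
by rewrite /= mem_iota IH add0n sw aw eqxx; split.
Qed.

Lemma uniq_words m k : uniq (words m k).
Proof.
elim: k => //= k IH; apply: allpairs_uniq => //; first exact: iota_uniq.
by move=> [x w] [y v] _ _ /= [-> ->].
Qed.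

Lemma mem_rows m k r :
  (r \in rows m k) = [&& sorted leq r, size r == k & all (fun x => x < m) r].
Proof. by rewrite mem_filter mem_words. Qed.

Lemma uniq_rows m k : uniq (rows m k).
Proof. exact/filter_uniq/uniq_words. Qed.

Lemma sorted_nth_leq s i j :
  sorted leq s -> i <= j -> j < size s -> nth 0 s i <= nth 0 s j.
Proof.
move=> ss ij js; apply: (sorted_leq_nth leq_trans leqnn) => //.
by rewrite inE (leq_ltn_trans ij js).
Qed.

Lemma sorted_cat_nth s t : sorted leq s -> sorted leq t ->
  (s != [::] -> t != [::] -> last 0 s <= head 0 t) -> sorted leq (s ++ t).
Proof.
case: s => [|x s] //= ps; case: t => [|y t] //= pt; first by rewrite cats0.
by rewrite cat_path ps /= pt andbT; apply.
Qed.

(* The overlap condition: the first [b] entries of the upper row [x] stand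
   directly above the last [b] entries of the lower row [w]. *)
Definition ov (b : nat) (x w : seq nat) : bool :=
  all (fun t => nth 0 x t < nth 0 w (size w - b + t)) (iota 0 b).

Lemma ovP b x w :
  reflect (forall t, t < b -> nth 0 x t < nth 0 w (size w - b + t)) (ov b x w).
Proof.
apply: (iffP allP) => h t tb; apply: h; first by rewrite mem_iota.
by move: tb; rewrite mem_iota.
Qed.

Lemma all_take_drop (T : Type) (a : pred T) i j s t :
  all a s -> all a t -> all a (take i s) && all a (drop j t).
Proof.
rewrite -{1}(cat_take_drop i s) -{1}(cat_take_drop j t) !all_cat.
by move=> /andP[-> _] /andP[_ ->].
Qed.

Section TailSwap.
Variables u v o : nat.
(* Rows of lengths [o + u + 1] and [v + o + 1] with overlap [o + 1]. *)

Definition crossing (x w : seq nat) : nat :=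
  find (fun t => ~~ (nth 0 x t < nth 0 w (v + t))) (iota 0 o.+1).

(** The lower row is cut just after the cell at the failure, the upper row just before it, so the
    new lengths are [o + u + v + 2] and [o]. *)
Definition swap_tails (p : seq nat * seq nat) : seq nat * seq nat :=
  let i := crossing p.1 p.2 in
  (take (v + i).+1 p.2 ++ drop i p.1, take i p.1 ++ drop (v + i).+1 p.2).

(** Recovers the cut from the new rows: before it they carry the entries compared by [crossing], and
    at it both entries come from the old lower row, so the comparison fails. The default [o] occurs
    when the short row comes entirely from the upper one. *)
Definition stop (l s : seq nat) : nat :=
  find (fun t => ~~ (nth 0 s t < nth 0 l (v + t))) (iota 0 o).

Definition unswap_tails (p : seq nat * seq nat) : seq nat * seq nat :=
  let i := stop p.1 p.2 in
  (take i p.2 ++ drop (v + i).+1 p.1, take (v + i).+1 p.1 ++ drop i p.2).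

Lemma find_iota_eq (a : pred nat) n i :
  i <= n -> (forall t, t < i -> ~~ a t) -> (i < n -> a i) ->
  find a (iota 0 n) = i.
Proof.
move=> le_in lt_i ai.
have hs : has a (iota 0 n) -> a (find a (iota 0 n)).
  by move=> h; have := nth_find 0 h; rewrite nth_iota // -{2}(size_iota 0 n) -has_find.
have sz : find a (iota 0 n) <= n by rewrite -{2}(size_iota 0 n) find_size.
case: (ltngtP (find a (iota 0 n)) i) => // h.
  have hh : has a (iota 0 n) by rewrite has_find size_iota (leq_trans h).
  by have := lt_i _ h; rewrite hs.
have := @before_find _ 0 a (iota 0 n) _ h.
have lt_in : i < n by apply: leq_trans sz.
by rewrite nth_iota // add0n ai.
Qed.

Lemma find_iotaP (a : pred nat) n :
  [/\ find a (iota 0 n) <= n,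
      forall t, t < find a (iota 0 n) -> ~~ a t &
      find a (iota 0 n) < n -> a (find a (iota 0 n))].
Proof.
have sz : find a (iota 0 n) <= n by rewrite -{2}(size_iota 0 n) find_size.
split=> // [t ht|hn].
  have := @before_find _ 0 a (iota 0 n) _ ht.
  by rewrite nth_iota ?add0n ?(leq_trans ht) // => ->.
have hh : has a (iota 0 n) by rewrite has_find size_iota.
by have := nth_find 0 hh; rewrite nth_iota.
Qed.

Variable m : nat.

(** Both new rows increase weakly: failure at [i] says [w_(v+i) <= x_i], and success at [i - 1]
    gives [x_(i-1) < w_(v+i-1) <= w_(v+i+1)]. The splittings of [x] and [w] serve to compare weights
    later. *)
Lemma swap_tailsP x w :
  x \in rows m (o + u).+1 -> w \in rows m (v + o).+1 -> ~~ ov o.+1 x w ->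
  [/\ (swap_tails (x, w)).1 \in rows m (o + u + v).+2,
      (swap_tails (x, w)).2 \in rows m o,
      unswap_tails (swap_tails (x, w)) = (x, w) &
      let i := crossing x w in
      [/\ i <= o, x = take i x ++ drop i x & w = take (v + i).+1 w ++ drop (v + i).+1 w]].
Proof.
rewrite !mem_rows => /and3P[sx /eqP zx ax] /and3P[sw /eqP zw aw] nov.
rewrite /swap_tails /=.
have [ilo ib ia] := find_iotaP (fun t => ~~ (nth 0 x t < nth 0 w (v + t))) o.+1.
rewrite -/(crossing x w) in ilo ib ia.
set i := crossing x w in ilo ib ia *.
(* The value [o + 1] would mean that the overlap condition never fails. *)
have lt_io : i < o.+1.
  rewrite ltn_neqAle ilo andbT; apply/eqP => ei; case/negP: nov; apply/ovP => t tb.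
  have := ib t; rewrite ei negbK => /(_ tb).
  by rewrite zw subSS addnK.
have {}ia := ia lt_io.
have viw : v + i < size w by rewrite zw; lia.
have ix : i < size x by rewrite zx; lia.
have tk : take (v + i).+1 w != [::] by rewrite -size_eq0 size_takel // zw; lia.
have s1 : sorted leq (take (v + i).+1 w ++ drop i x).
  apply: sorted_cat_nth; rewrite ?take_sorted ?drop_sorted // => _ _.
  rewrite -nth_last -nth0 nth_drop addn0 size_takel // nth_take //=.
  by rewrite leqNgt.
have s2 : sorted leq (take i x ++ drop (v + i).+1 w).
  apply: sorted_cat_nth; rewrite ?take_sorted ?drop_sorted // => t1 t2.
  have i0 : 0 < i by move: t1; rewrite -size_eq0 size_takel ?lt0n // ltnW.
  have d0 : (v + i).+1 < size w by move: t2; rewrite -size_eq0 size_drop; lia.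
  rewrite -nth_last -nth0 nth_drop addn0 size_takel ?(ltnW ix) // nth_take; last lia.
  have := ib i.-1; rewrite negbK => /(_ ltac:(lia)) /ltnW h.
  by apply: leq_trans h _; apply: sorted_nth_leq => //; lia.
split; last by rewrite !cat_take_drop.
- rewrite s1 size_cat size_takel // size_drop zx all_cat; apply/and3P; split=> //.
    by apply/eqP; lia.
  by rewrite all_take_drop.
- rewrite s2 size_cat size_takel 1?ltnW // size_drop zw all_cat; apply/and3P; split=> //.
    by apply/eqP; lia.
  by rewrite all_take_drop.
rewrite /unswap_tails /=.
have -> : stop (take (v + i).+1 w ++ drop i x) (take i x ++ drop (v + i).+1 w) = i.
  apply: find_iota_eq => // [t ti|io].
    rewrite negbK !nth_cat !size_takel // ?(ltnW ix) // ti.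
    have -> : v + t < (v + i).+1 by lia.
    rewrite !nth_take //; last lia.
    by have := ib t ti; rewrite negbK.
  rewrite !nth_cat !size_takel // ?(ltnW ix) // ltnn ltnS leqnn subnn nth_take // nth_drop.
  by rewrite -leqNgt addn0; apply: sorted_nth_leq => //; rewrite zw; lia.
by rewrite !take_cat !drop_cat !size_takel // ?(ltnW ix) // !ltnn !subnn !take0 !drop0 !cats0
  !cat_take_drop.
Qed.

(** At the cut [i] the new rows are compared through two consecutive entries of [l] in the wrong
    order, so a failure exists even when [i = o]. *)
Lemma unswap_tailsP l s : l \in rows m (o + u + v).+2 -> s \in rows m o ->
  [/\ (unswap_tails (l, s)).1 \in rows m (o + u).+1,
      (unswap_tails (l, s)).2 \in rows m (v + o).+1,
      ~~ ov o.+1 (unswap_tails (l, s)).1 (unswap_tails (l, s)).2 &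
      swap_tails (unswap_tails (l, s)) = (l, s)].
Proof.
rewrite !mem_rows => /and3P[sl /eqP zl al] /and3P[ss /eqP zs as_].
have [ilo ib ia] := find_iotaP (fun t => ~~ (nth 0 s t < nth 0 l (v + t))) o.
rewrite -/(stop l s) in ilo ib ia.
rewrite /unswap_tails /=; set i := stop l s in ilo ib ia *.
have il : (v + i).+1 < size l by rewrite zl; lia.
have is_ : i <= size s by rewrite zs.
have s1 : sorted leq (take i s ++ drop (v + i).+1 l).
  apply: sorted_cat_nth; rewrite ?take_sorted ?drop_sorted // => t1 _.
  have i0 : 0 < i by move: t1; rewrite -size_eq0 size_takel // lt0n.
  rewrite -nth_last -nth0 nth_drop addn0 size_takel // nth_take; last lia.
  have := ib i.-1; rewrite negbK => /(_ ltac:(lia)) /ltnW h.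
  by apply: leq_trans h _; apply: sorted_nth_leq => //; lia.
have s2 : sorted leq (take (v + i).+1 l ++ drop i s).
  apply: sorted_cat_nth; rewrite ?take_sorted ?drop_sorted // => _ t2.
  have d0 : i < o by move: t2; rewrite -size_eq0 size_drop zs; lia.
  rewrite -nth_last -nth0 nth_drop addn0 size_takel ?(ltnW il) // nth_take //=.
  by have := ia d0; rewrite -leqNgt.
have z1 : size (take i s ++ drop (v + i).+1 l) = (o + u).+1.
  by rewrite size_cat size_takel // size_drop zl; lia.
have z2 : size (take (v + i).+1 l ++ drop i s) = (v + o).+1.
  by rewrite size_cat size_takel 1?ltnW // size_drop zs; lia.
have cr : crossing (take i s ++ drop (v + i).+1 l) (take (v + i).+1 l ++ drop i s) = i.
  apply: find_iota_eq => [|t ti|io]; first exact: leqW.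
    rewrite negbK !nth_cat !size_takel // ?(ltnW il) // ti.
    have -> : v + t < (v + i).+1 by lia.
    rewrite !nth_take //; last lia.
    by have := ib t ti; rewrite negbK.
  rewrite !nth_cat !size_takel // ?(ltnW il) // ltnn ltnS leqnn subnn nth_take // nth_drop.
  by rewrite -leqNgt addn0; apply: sorted_nth_leq.
split.
- rewrite s1 z1 eqxx all_cat /=.
  by rewrite all_take_drop.
- rewrite s2 z2 eqxx all_cat /=.
  by rewrite all_take_drop.
- apply/ovP => /(_ i); rewrite z2 subSS addnK ltnS ilo => /(_ isT).
  rewrite !nth_cat !size_takel // ?(ltnW il) // ltnn ltnS leqnn subnn nth_take // nth_drop.
  by rewrite ltnNge addn0 sorted_nth_leq.
rewrite /swap_tails /= cr.
by rewrite !take_cat !drop_cat !size_takel // ?(ltnW il) // !ltnn !subnn !take0 !drop0 !cats0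
  !cat_take_drop.
Qed.

End TailSwap.

(** * Generating functions of chains of rows *)

Section ChainGF.
Local Open Scope ring_scope.
Variables (R : comNzRingType) (m : nat) (X : nat -> R).

Definition wt (r : seq nat) : R := \prod_(c <- r) X c.

Lemma wt_cat r s : wt (r ++ s) = wt r * wt s.
Proof. exact: big_cat. Qed.

(** Sums over all rows that can be placed below [x]; carrying [x] along makes the overlap condition
    local. *)
Fixpoint tails (x be al : seq nat) : R :=
  match al, be with
  | l :: al', b :: be' => \sum_(w <- rows m l | ov b x w) wt w * tails w be' al'
  | _, _ => 1
  end.

(** An empty row on top with overlap 0 imposes no condition. *)
Definition chain_gf (al be : seq nat) : R := tails [::] (0%N :: be) al.

(** [L] and [M] stand for the rows above and below the pair. They see only the last [bl] entries of
    the upper and the first [br] entries of the lower row. The long row keeps at least [u + 1] and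
    [v + 1] of these, so both factors pass to it unchanged. *)
Lemma tail_swap u v o bl br (L M : seq nat -> R) :
  (bl <= u.+1)%N -> (br <= v.+1)%N ->
  (forall s t1 t2, (bl <= size s)%N -> L (t1 ++ s) = L (t2 ++ s)) ->
  (forall s t1 t2, (br <= size s)%N -> M (s ++ t1) = M (s ++ t2)) ->
  \sum_(x <- rows m (o + u).+1) \sum_(w <- rows m (v + o).+1 | ov o.+1 x w)
     L x * wt x * (wt w * M w)
  + (\sum_(l <- rows m (o + u + v).+2) L l * wt l * M l) * (\sum_(s <- rows m o) wt s)
  = (\sum_(x <- rows m (o + u).+1) L x * wt x) * (\sum_(w <- rows m (v + o).+1) wt w * M w).
Proof.
move=> blu brv LE ME.
have pairE (F : seq nat * seq nat -> R) A B :
    \sum_(x <- A) \sum_(w <- B) F (x, w) = \sum_(p <- [seq (x, w) | x <- A, w <- B]) F p.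
  by rewrite big_allpairs_dep.
rewrite [RHS]big_distrl /= [RHS](eq_bigr (fun x =>
    \sum_(w <- rows m (v + o).+1 | ov o.+1 x w) L x * wt x * (wt w * M w)
  + \sum_(w <- rows m (v + o).+1 | ~~ ov o.+1 x w) L x * wt x * (wt w * M w))); last first.
  by move=> x _; rewrite big_distrr /= (bigID (ov o.+1 x)).
(* Pairs meeting the overlap condition agree on both sides; the failing pairs are left to the
   exchange. *)
rewrite big_split /=; congr (_ + _).
rewrite big_distrl /=.
under eq_bigr => l _ do rewrite big_distrr /=.
rewrite (pairE (fun p => L p.1 * wt p.1 * M p.1 * wt p.2)).
under [RHS]eq_bigr => x _ do rewrite big_mkcond /=.
rewrite (pairE (fun p =>
  if ~~ ov o.+1 p.1 p.2 then L p.1 * wt p.1 * (wt p.2 * M p.2) else 0)) /=.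
rewrite -[RHS]big_mkcond -[RHS]big_filter /=.
have pairs_uniq a b : uniq [seq (x, w) | x <- rows m a, w <- rows m b].
  by apply: allpairs_uniq; rewrite ?uniq_rows // => -[? ?] [? ?] _ _ /= [-> ->].
symmetry.
apply: (@big_seq_bij _ _ _ _ _ (swap_tails v o) (unswap_tails v o)).
- exact: filter_uniq.
- exact: pairs_uniq.
- move=> [x w]; rewrite mem_filter => /andP[/= nov /allpairsP[[x' w'] [/= xr wr [ex ew]]]].
  rewrite -{}ex in xr; rewrite -{}ew in wr => {x' w'}.
  have [h1 h2 h3 [i_o ex ew]] := swap_tailsP xr wr nov.
  split=> //; first by apply/allpairsP; exists (swap_tails v o (x, w)); split=> //; case: (swap_tails _ _ _).
  move: xr wr; rewrite !mem_rows => /and3P[_ /eqP zx _] /and3P[_ /eqP zw _].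
  rewrite /swap_tails /=; set i := crossing v o x w in i_o ex ew *.
  have -> : L (take (v + i).+1 w ++ drop i x) = L x.
    by rewrite [in RHS]ex; apply: LE; rewrite size_drop zx; lia.
  have -> : M (take (v + i).+1 w ++ drop i x) = M w.
    by rewrite [in RHS]ew; apply: ME; rewrite size_takel ?zw; lia.
  by rewrite [in wt x]ex [in wt w]ew !wt_cat; ring.
move=> [l s] /allpairsP[[l' s'] [/= lr sr [el es]]].
rewrite -{}el in lr; rewrite -{}es in sr => {l' s'}.
have [h1 h2 h3 h4] := unswap_tailsP lr sr; split=> //.
rewrite mem_filter h3; apply/allpairsP.
by exists (unswap_tails v o (l, s)); split=> //; case: (unswap_tails _ _ _).
Qed.

Lemma ov_drop b x w1 w2 s : (b <= size s)%N -> ov b x (w1 ++ s) = ov b x (w2 ++ s).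
Proof.
move=> bs; apply: eq_in_all => t; rewrite mem_iota add0n => /andP[_ tb].
rewrite !nth_cat !size_cat; congr (_ < _)%N.
have -> : (size w1 + size s - b + t < size w1)%N = false by lia.
have -> : (size w2 + size s - b + t < size w2)%N = false by lia.
by congr nth; lia.
Qed.

Lemma ov_take b s x1 x2 w : (b <= size s)%N -> ov b (s ++ x1) w = ov b (s ++ x2) w.
Proof.
move=> bs; apply: eq_in_all => t; rewrite mem_iota add0n => /andP[_ tb].
by rewrite !nth_cat (leq_trans tb bs).
Qed.

Lemma tails_take be al s x1 x2 : (head 0%N be <= size s)%N ->
  tails (s ++ x1) be al = tails (s ++ x2) be al.
Proof.
case: al be => [|l al] [|b be] //= bs.
by apply: eq_bigl => w; apply: ov_take.
Qed.

(** Induction on the rows above the pair. The overlap [b0] touches the row [u] only when [P] is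
    empty, hence its conditional bound. *)
Lemma tails_swap r bP P u v o bQ Q :
  size bP = size P -> (0 < o <= minn u v)%N ->
  (forall bl, bl = last 0%N bP -> bl <= u - o + 1)%N -> (head 0%N bQ <= v - o + 1)%N ->
  forall b0, (P = [::] -> b0 <= u - o + 1)%N ->
  tails r (b0 :: bP ++ o :: bQ) (P ++ [:: u, v & Q])
  + tails r (b0 :: bP ++ bQ) (P ++ (u + v - o + 1)%N :: Q) * chain_gf [:: o.-1] [::]
  = tails r (b0 :: bP) (P ++ [:: u]) * chain_gf (v :: Q) bQ.
Proof.
move=> szP ouv + hQ; elim: P bP szP r => [|l P IH] [|b1 bP] //= => [_|[szP]] r hP b0 hb0.
  (* The row above enters as the indicator of its overlap condition, the rows below as their
     generating function. *)
  have := @tail_swap (u - o) (v - o) o.-1 b0 (head 0%N bQ)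
    (fun x => (ov b0 r x)%:R) (fun w => tails w bQ Q).
  have -> : (o.-1 + (u - o)).+1 = u by lia.
  have -> : (v - o + o.-1).+1 = v by lia.
  have -> : (o.-1 + (u - o) + (v - o)).+2 = (u + v - o + 1)%N by lia.
  have -> : o.-1.+1 = o by lia.
  have hb := hb0 erefl.
  have hL s t1 t2 : (b0 <= size s)%N -> (ov b0 r (t1 ++ s))%:R = (ov b0 r (t2 ++ s))%:R :> R.
    by move=> h; rewrite (ov_drop _ t1 t2).
  have hM s t1 t2 : (head 0%N bQ <= size s)%N -> tails (s ++ t1) bQ Q = tails (s ++ t2) bQ Q.
    exact: tails_take.
  rewrite /chain_gf /= => /(_ ltac:(lia) ltac:(lia) hL hM) e.
  have fold_if (c : bool) (y z : R) : (if c then y * z else 0) = c%:R * y * z.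
    by case: c; rewrite ?mul1r ?mul0r.
  have e1 : \sum_(x <- rows m u | ov b0 r x) wt x * (\sum_(w <- rows m v | ov o x w)
        wt w * tails w bQ Q)
      = \sum_(x <- rows m u) \sum_(w <- rows m v | ov o x w)
          (ov b0 r x)%:R * wt x * (wt w * tails w bQ Q).
    by rewrite big_mkcond; apply: eq_bigr => x _; rewrite fold_if big_distrr.
  have e2 n : \sum_(l <- rows m n | ov b0 r l) wt l * tails l bQ Q
      = \sum_(l <- rows m n) (ov b0 r l)%:R * wt l * tails l bQ Q.
    by rewrite big_mkcond; apply: eq_bigr => l _; rewrite fold_if.
  have e3 n : \sum_(l <- rows m n | ov b0 r l) wt l * 1
      = \sum_(l <- rows m n) (ov b0 r l)%:R * wt l.
    by rewrite big_mkcond; apply: eq_bigr => l _; rewrite fold_if mulr1.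
  have e4 n : \sum_(l <- rows m n) wt l * 1 = \sum_(l <- rows m n) wt l.
    by apply: eq_bigr => l _; rewrite mulr1.
  rewrite e1 e2 e3 e4.
  exact: e.
rewrite big_distrl [RHS]big_distrl -big_split /=.
apply: eq_bigr => w _; rewrite -!mulrA -mulrDr; congr (_ * _).
apply: IH => // [bl ebl|eP].
  by move: hP ebl; case: (bP) => [|b2 bP'] hP ->; last exact: hP.
by apply: (hP); move: szP hP; rewrite eP; case: (bP).
Qed.

(* This is (D). Only the first [v - o + 1] entries of the row [v] and the last
   [u - o + 1] entries of the row [u] survive in the long row, hence the bounds on
   the neighbouring overlaps. *)
Theorem chain_gf_swap P bP u v o bQ Q :
  size bP = size P -> (0 < o <= minn u v)%N ->
  (last 0%N bP <= u - o + 1)%N -> (head 0%N bQ <= v - o + 1)%N ->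
  chain_gf (P ++ [:: u, v & Q]) (bP ++ o :: bQ)
  + chain_gf (P ++ (u + v - o + 1)%N :: Q) (bP ++ bQ) * chain_gf [:: o.-1] [::]
  = chain_gf (P ++ [:: u]) bP * chain_gf (v :: Q) bQ.
Proof.
move=> szP ouv hP hQ; apply: tails_swap => //.
by move=> bl ->.
Qed.
End ChainGF.

(** * The telescoping recursion *)

Section RowShift.
Local Open Scope ring_scope.
Variables (R : comNzRingType) (a : nat).
(* [h], [S], [T k], [J k] are as in the header with [tau] replaced by [a^k, tau];
   [S' j] and [J' j k] have [sigma] replaced by [sigma, a + 1, a^j]. *)
Variables (h S : nat -> R) (T J S' : nat -> nat -> R) (J' : nat -> nat -> nat -> R).

(** Each recursion is (D) at overlap 1, cutting between the row [v] and a neighbour; [J'] can be cut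
    on either side of [v]. *)
Hypothesis TS : forall k v, (0 < v)%N -> T k.+1 v = h v * T k a - T k (a + v)%N.
Hypothesis JS : forall k v, (0 < v)%N -> J k.+1 v = S v * T k a - J k (a + v)%N.
Hypothesis S'0 : forall v, (0 < v)%N -> S' 0 v = S a.+1 * h v - S (a.+1 + v)%N.
Hypothesis S'S : forall j v, (0 < v)%N -> S' j.+1 v = S' j a * h v - S' j (a + v)%N.
Hypothesis J'0 : forall k v, (0 < v)%N -> J' 0 k v = S a.+1 * T k v - J k (a.+1 + v)%N.
Hypothesis J'Sl : forall j k v, (0 < v)%N -> J' j.+1 k v = S' j a * T k v - J' j k (a + v)%N.
Hypothesis J'Sr : forall j k v, (0 < v)%N -> J' j k.+1 v = S' j v * T k a - J' j k (a + v)%N.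

(** The [j]-th term is the effect of exchanging adjacent rows [u, v] between [a^j] and [a^(k-1-j)]:
    in both orders the merged row is [u + v], which cancels. *)
Definition swap_sum k u v : R :=
  \sum_(0 <= j < k) (S' j u * T (k.-1 - j) v - S' j v * T (k.-1 - j) u).

(** At [c = a] this is the difference in (ii) with [n = k + 2]; general [c] is there because the
    recursion raises [c]. *)
Definition shift_defect k c : R := S c * T k c - S c.+1 * T k c.-1 - swap_sum k c c.-1.

Hypothesis a_gt1 : (1 < a)%N.

Lemma swap_sum_row k : swap_sum k a a.-1 = J' k 0 a.-1 - J' 0 k a.-1.
Proof.
have a0 : (0 < a)%N by lia.
have a1 : (0 < a.-1)%N by lia.
rewrite /swap_sum.
rewrite (eq_big_nat _ _ (F2 := fun j => J' j.+1 (k - j.+1) a.-1 - J' j (k - j) a.-1)).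
  by rewrite telescope_sumr // subnn subn0.
move=> j /andP[_ jk]; have -> : (k - j = (k.-1 - j).+1)%N by lia.
have -> : (k - j.+1 = k.-1 - j)%N by lia.
rewrite J'Sl // J'Sr //; ring.
Qed.

(** Both products carry the merged row [2a], so they differ by [J (k+1) a - J' 0 k (a-1)]; the swap
    sum then moves the row [a - 1] below all rows [a]. *)
Lemma shift_defectE k : shift_defect k a = J k.+1 a - J' k 0 a.-1.
Proof.
have a0 : (0 < a)%N by lia.
have a1 : (0 < a.-1)%N by lia.
rewrite /shift_defect swap_sum_row J'0 // JS //.
have -> : (a.+1 + a.-1 = a + a)%N by lia.
ring.
Qed.

(** The row [v] is glued to the [a] below it in the products [A] and to the [a] above it in the
    products [B], which yields the pair [(a + v, u)]. The terms with factor [h v] telescope. *)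
Lemma swap_sumS k u v : (0 < u)%N -> (0 < v)%N ->
  swap_sum k.+2 u v = S (a.+1 + v)%N * T k.+1 u - J k.+1 (a.+1 + u)%N * h v
    - (J' k.+1 0 u * h v - S' k.+1 u * T 0 v) + swap_sum k.+1 (a + v)%N u.
Proof.
move=> u0 v0; rewrite /swap_sum /=.
pose A j := S' j u * T (k.+1 - j)%N v; pose B j := S' j v * T (k.+1 - j)%N u.
pose C j := h v * J' j (k.+1 - j)%N u.
rewrite [X in _ + X](eq_big_nat _ _ (F2 := fun j => A j - B j.+1 + (C j.+1 - C j))); last first.
  move=> j /andP[_ jk]; rewrite /A /B /C.
  have -> : (k.+1 - j = (k - j).+1)%N by lia.
  have -> : (k.+1 - j.+1 = k - j)%N by lia.
  rewrite TS // S'S // J'Sl // J'Sr //; ring.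
(* Only [A (k+1)], [B 0] and the two end values of [C] survive. *)
rewrite sumrB big_split /= telescope_sumr // sumrB.
rewrite [\sum_(0 <= i < k.+2) S' i u * _]big_nat_recr //=.
rewrite [\sum_(0 <= i < k.+2) S' i v * _]big_nat_recl //=.
by rewrite /A /B /C !subn0 !subnn S'0 // J'0 //; ring.
Qed.

Lemma swap_sum1 u v : (0 < u)%N -> (0 < v)%N ->
  swap_sum 1 u v = S (a.+1 + v)%N * T 0 u - J 0 (a.+1 + u)%N * h v
    - (J' 0 0 u * h v - S' 0 u * T 0 v).
Proof. by move=> u0 v0; rewrite /swap_sum big_nat1 /= !S'0 // J'0 //; ring. Qed.

Lemma shift_defect0 c :
  shift_defect 0 c = (S c * T 0 c - J 0 c.+1 * h c.-1)
    + (J 0 c.+1 * h c.-1 - S c.+1 * T 0 c.-1).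
Proof. rewrite /shift_defect /swap_sum big_geq //; ring. Qed.

Lemma shift_defect1 c : (1 < c)%N ->
  shift_defect 1 c = (S c * T 1 c - J 1 c.+1 * h c.-1)
    + (S c.+1 * T 0 (a + c).-1 - J 0 (a + c)%N * h c)
    + (J 0 (a + c)%N * h c - S (a + c)%N * T 0 c)
    + (J' 0 0 c * h c.-1 - S' 0 c * T 0 c.-1).
Proof.
move=> c1; have c0 : (0 < c)%N by lia.
have c2 : (0 < c.-1)%N by lia.
rewrite /shift_defect swap_sum1 // !TS // !JS //.
have -> : (a.+1 + c.-1 = a + c)%N by lia.
have -> : (a + c.-1 = (a + c).-1)%N by lia.
rewrite addnS addSn; ring.
Qed.

(** Two steps of the swap recursion lead from [(c, c-1)] through [(a+c-1, c)] to [(a+c, a+c-1)], the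
    pair belonging to the defect at [a + c]. *)
Lemma shift_defectS k c : (1 < c)%N ->
  shift_defect k.+2 c = (S c * T k.+2 c - J k.+2 c.+1 * h c.-1)
    + (S c.+1 * T k.+1 (a + c).-1 - J k.+1 (a + c)%N * h c)
    + (J' k.+1 0 c * h c.-1 - S' k.+1 c * T 0 c.-1)
    + (J' k 0 (a + c).-1 * h c - S' k (a + c).-1 * T 0 c)
    + shift_defect k (a + c).
Proof.
move=> c1; have c0 : (0 < c)%N by lia.
have c2 : (0 < c.-1)%N by lia.
have d0 : (0 < (a + c).-1)%N by lia.
have d1 : (0 < a + c)%N by lia.
rewrite /shift_defect swap_sumS //.
(* The second step; for [k = 0] the recursion ends and the remaining swap sum is empty. *)
have -> : swap_sum k.+1 (a + c.-1)%N c =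
    S (a + c).+1 * T k (a + c).-1 - J k (a + (a + c))%N * h c
    - (J' k 0 (a + c).-1 * h c - S' k (a + c).-1 * T 0 c)
    + swap_sum k (a + c)%N (a + c).-1.
  have e1 : (a + c.-1 = (a + c).-1)%N by lia.
  have e2 : (a.+1 + (a + c).-1 = a + (a + c))%N by lia.
  rewrite e1; case: k => [|k]; first rewrite swap_sum1 // [in RHS]/swap_sum big_geq //.
    by rewrite e2 addSn; ring.
  by rewrite swap_sumS // e2 addSn; ring.
rewrite !(TS k.+1) // !(JS k.+1) //.
have -> : (a.+1 + c.-1 = a + c)%N by lia.
have -> : (a + c.-1 = (a + c).-1)%N by lia.
rewrite addnS addSn (JS k d1) (TS k c0); ring.
Qed.

End RowShift.

(** * Sums of skew Schur functions *)

Fixpoint valid_from (l : nat) (al be : seq nat) : bool :=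
  match al, be with
  | l' :: al', b :: be' => (b <= minn l l') && valid_from l' al' be'
  | [::], [::] => true
  | _, _ => false
  end.

Definition valid_shape (al be : seq nat) : bool :=
  if al is l :: al' then valid_from l al' be else false.

Lemma valid_shape_cat P bP u Q bQ : size bP = size P ->
  valid_shape (P ++ u :: Q) (bP ++ bQ) =
  valid_shape (P ++ [:: u]) bP && valid_shape (u :: Q) bQ.
Proof.
case: P bP => [|l P] [|b bP] //= /eqP; rewrite eqSS => /eqP.
elim: P b l bP => [|l' P IH] b l [|b' bP] //= => [_|[szP]]; first by rewrite andbT.
by rewrite IH // andbA.
Qed.

(* The list of shapes must not depend on the number [m] of letters. *)
Definition family := forall R : comNzRingType, nat -> (nat -> R) -> R.

Definition skew_sum (F : family) : Prop :=
  exists2 l : seq (seq nat * seq nat), all (fun p => valid_shape p.1 p.2) l &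
    forall R m X, F R m X = (\sum_(p <- l) chain_gf m X p.1 p.2)%R.

Lemma skew_sum_ext F G : (forall R m X, F R m X = G R m X) -> skew_sum F -> skew_sum G.
Proof. by move=> FG [l vl e]; exists l => // R m X; rewrite -FG. Qed.

Lemma skew_sum0 : skew_sum (fun _ _ _ => 0%R).
Proof. by exists [::] => // R m X; rewrite big_nil. Qed.

Lemma skew_sumD F G : skew_sum F -> skew_sum G ->
  skew_sum (fun R m X => F R m X + G R m X)%R.
Proof.
move=> [l vl e] [l' vl' e']; exists (l ++ l') => [|R m X]; first by rewrite all_cat vl.
by rewrite big_cat e e'.
Qed.

Lemma skew_sum_shape al be : valid_shape al be ->
  skew_sum (fun R m X => chain_gf m X al be).
Proof.
by move=> v; exists [:: (al, be)] => [|R m X]; rewrite /= ?v // big_seq1.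
Qed.

(** What (D) asks of the rows above the cut: a last overlap of at most 1 meets the bound [u - o + 1]
    for every admissible [o]. *)
Definition left_ctx (P bP : seq nat) : Prop :=
  [/\ size bP = size P, last 0 bP <= 1 & forall u, 0 < u -> valid_shape (P ++ [:: u]) bP].

Definition right_ctx (Q bQ : seq nat) : Prop :=
  head 0 bQ <= 1 /\ forall u, 0 < u -> valid_shape (u :: Q) bQ.

Lemma left_ctx_rcons P bP a : 0 < a -> left_ctx P bP -> left_ctx (P ++ [:: a]) (bP ++ [:: 1]).
Proof.
move=> a0 [szP lP vP]; split=> [||u u0]; first by rewrite !size_cat szP.
  by rewrite last_cat.
by rewrite -catA valid_shape_cat // vP //= andbT leq_min a0.
Qed.

Lemma right_ctx_cons Q bQ a : 0 < a -> right_ctx Q bQ -> right_ctx (a :: Q) (1 :: bQ).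
Proof.
move=> a0 [hQ vQ]; split=> // u u0.
by have /= -> := vQ _ a0; rewrite leq_min u0 a0.
Qed.

(** * The product rule in context and the two positive differences *)

Section Contexts.
Local Open Scope ring_scope.
Variables (R : comNzRingType) (m : nat) (X : nat -> R).
Notation N := (chain_gf m X).

Lemma chain_gf_nil : N [:: 0%N] [::] = 1.
Proof. by rewrite /chain_gf /= big_seq1 /wt big_nil mul1r. Qed.

Lemma chain_gf_join P bP u v Q bQ : left_ctx P bP -> right_ctx Q bQ ->
  (0 < u)%N -> (0 < v)%N ->
  N (P ++ [:: u, v & Q]) (bP ++ 1%N :: bQ) =
    N (P ++ [:: u]) bP * N (v :: Q) bQ - N (P ++ (u + v)%N :: Q) (bP ++ bQ).
Proof.
move=> [szP lP _] [hQ _] u0 v0.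
rewrite -(@chain_gf_swap _ m X P bP u v 1 bQ Q) //; try lia.
by rewrite /= chain_gf_nil mulr1 addn1 subn1 prednK ?addn_gt0 ?u0 // addrK.
Qed.

Lemma chain_gf_overlap P bP u v o Q bQ : left_ctx P bP -> right_ctx Q bQ ->
  (0 < o <= minn u v)%N ->
  N (P ++ [:: u, v & Q]) (bP ++ o :: bQ) =
    N (P ++ [:: u]) bP * N (v :: Q) bQ
    - N (P ++ (u + v - o).+1 :: Q) (bP ++ bQ) * N [:: o.-1] [::].
Proof.
move=> [szP lP _] [hQ _] ouv.
rewrite -(@chain_gf_swap _ m X P bP u v o bQ Q) //; try lia.
by rewrite addn1 addrK.
Qed.
End Contexts.

(** By (D) the difference is the single shape with rows [u, v] and overlap [o]. *)
Lemma skew_sum_overlap P bP u v o Q bQ n o' : left_ctx P bP -> right_ctx Q bQ ->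
  0 < o <= minn u v -> n = (u + v - o).+1 -> o' = o.-1 ->
  skew_sum (fun R m X => chain_gf m X (P ++ [:: u]) bP * chain_gf m X (v :: Q) bQ
    - chain_gf m X (P ++ n :: Q) (bP ++ bQ) * chain_gf m X [:: o'] [::])%R.
Proof.
move=> cP cQ ouv -> ->; have vs : valid_shape (P ++ [:: u, v & Q]) (bP ++ o :: bQ).
  case: cP cQ => szP _ vP [_ vQ].
  rewrite valid_shape_cat // vP /=; last lia.
  by have /= -> := vQ v ltac:(lia); rewrite andbT; case/andP: ouv.
apply: skew_sum_ext (skew_sum_shape vs) => R m X.
by rewrite chain_gf_overlap.
Qed.

(* Since [T_v = {tau} h_v - {v + tau_1, tau_2, ..}], and likewise for [J_u], the
   difference is the shape with rows [u, v + tau_1] and overlap [v + 1]. *)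
Lemma skew_sum_merge P bP u v Q bQ : left_ctx P bP -> right_ctx Q bQ ->
  (Q <> [::] -> head 0 bQ = 1) -> all (leq 1) Q -> (forall b, ohead (behead bQ) = Some b -> b <= head 0 Q) ->
  0 < v < u ->
  skew_sum (fun R m X => chain_gf m X (P ++ u :: Q) (bP ++ bQ) * chain_gf m X [:: v] [::]
    - chain_gf m X (P ++ [:: u]) bP * chain_gf m X (v :: Q) bQ)%R.
Proof.
move=> cP; have [szP lP vP] := cP; move=> cQ; have [hQ vQ] := cQ.
case: Q bQ cQ hQ vQ => [|q Q] [|b bQ] cQ hQ vQ; try by have := vQ 1 isT.
  by move=> _ _ _ _; apply: skew_sum_ext skew_sum0 => R m X; rewrite cats0 subrr.
move=> /(_ ltac:(by [])) /= -> /andP[q0 _] hb /andP[v0 vu].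
(* This is the bound (D) needs below the row [v + q] at overlap [v + 1]. *)
have hb' : head 0 bQ <= q by move: hb; case: (bQ) => //= b' bQ' /(_ _ erefl).
have vs : valid_shape (P ++ [:: u, v + q & Q]) (bP ++ v.+1 :: bQ).
  rewrite valid_shape_cat // vP /=; last lia.
  have := vQ 1 isT; move: hb'; case: (Q) => [|q' Q'] /=.
    by case: (bQ) => [|? ?]; rewrite ?andbF // => _; lia.
  case: (bQ) => [|b' bQ'] /= hb'; rewrite ?andbF // => /andP[_ /andP[h ->]]; rewrite andbT; lia.
apply: skew_sum_ext (skew_sum_shape vs) => R m X.
(* (D) for the glued shape, then the product rule for the pairs [v, q] and [u, q]; the claim is a
   linear combination of the three. *)
have e1 := @chain_gf_swap R m X P bP u (v + q) v.+1 bQ Q szP ltac:(lia) ltac:(lia) ltac:(lia).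
have e2 := @chain_gf_swap R m X [::] [::] v q 1 bQ Q erefl ltac:(lia) ltac:(simpl; lia) ltac:(lia).
have e3 := @chain_gf_swap R m X P bP u q 1 bQ Q szP ltac:(lia) ltac:(lia) ltac:(lia).
move: e1 e2 e3; rewrite /= chain_gf_nil !mulr1.
have -> : u + (v + q) - v.+1 + 1 = u + q by lia.
have -> : v + q - 1 + 1 = v + q by lia.
have -> : u + q - 1 + 1 = u + q by lia.
move=> e1 e2 e3.
apply: (addIr (chain_gf m X (P ++ (u + q)%N :: Q) (bP ++ bQ) * chain_gf m X [:: v] [::])%R).
rewrite e1; move/(canRL (addKr _)): e2 => ->; move/(canRL (addKr _)): e3 => ->.
by rewrite /=; ring.
Qed.

Lemma valid_from_nth l al be :
  valid_from l al be = (size be == size al) &&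
    all (fun i => nth 0 be i <= minn (nth 0 (l :: al) i) (nth 0 al i)) (iota 0 (size al)).
Proof.
elim: al l be => [|l' al IH] l [|b be] //=.
by rewrite IH eqSS -[1]/(1 + 0) iotaDl all_map andbCA.
Qed.

Lemma valid_shape_nth al be : 0 < size al ->
  valid_shape al be = (size be == (size al).-1) &&
    all (fun i => nth 0 be i <= minn (nth 0 al i) (nth 0 al i.+1)) (iota 0 (size al).-1).
Proof. by case: al => [|l al] //= _; rewrite valid_from_nth. Qed.

Lemma standing_left_ctx sigma tau sb tb : standing_hyp sigma tau sb tb -> left_ctx sigma sb.
Proof.
move=> [ps [_ [ss [_ [ls [_ [os _]]]]]]].
split=> // [|u u0].
  case: (posnP (size sigma)) => s0; first by move: ss; rewrite s0; case: (sb).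
  by rewrite -nth_last ss ls.
rewrite valid_shape_nth size_cat ?addn1 //= ss eqxx /=.
apply/allP => i; rewrite mem_iota add0n => /andP[_ lt_i].
rewrite !nth_cat lt_i; case: ltnP => h; first exact: os.
have ei : i = (size sigma).-1 by lia.
have -> : i.+1 - size sigma = 0 by lia.
rewrite ei ls /=; last lia.
by rewrite leq_min u0 andbT; apply: (allP ps); apply: mem_nth; rewrite ltn_predL; lia.
Qed.

Lemma standing_right_ctx sigma tau sb tb : standing_hyp sigma tau sb tb -> right_ctx tau tb.
Proof.
move=> [_ [pt [_ [st [_ [lt_ [_ ot]]]]]]].
split=> [|u u0].
  case: (posnP (size tau)) => s0; first by move: st; rewrite s0; case: (tb).
  by rewrite -nth0 lt_.
rewrite /= valid_from_nth st eqxx /=; apply/allP => i; rewrite mem_iota add0n => /andP[_ lt_i].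
case: i lt_i => [|i] lt_i; last by rewrite /= minnC; apply: (ot i.+1).
rewrite lt_ //= leq_min u0 /=; apply: (allP pt); exact: mem_nth.
Qed.

(** * The differences in (i) and (ii) as sums of shapes *)

Section Main.
Variables (sigma tau sb tb : seq nat).
Hypothesis hyp : standing_hyp sigma tau sb tb.

Let cS : left_ctx sigma sb := standing_left_ctx hyp.
Let cT : right_ctx tau tb := standing_right_ctx hyp.

Lemma standing_merge P bP u v : left_ctx P bP -> 0 < v < u ->
  skew_sum (fun R m X => chain_gf m X (P ++ u :: tau) (bP ++ tb) * chain_gf m X [:: v] [::]
    - chain_gf m X (P ++ [:: u]) bP * chain_gf m X (v :: tau) tb)%R.
Proof.
move=> cP uv; move: hyp => [_ [pt [_ [st [_ [lt_ [_ ot]]]]]]].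
apply: skew_sum_merge => // [t0|b eb]; first by rewrite -nth0 lt_ // lt0n size_eq0; apply/eqP.
case: (tb) st ot eb => [|b0 [|b1 tb']] //= st ot [<-].
by move: (ot 1); rewrite -st /= minnC leq_min nth0 => /(_ isT) /andP[].
Qed.

Lemma skew_sum_two_rows a b : 2 <= b -> b <= a ->
  skew_sum (fun R m X => chain_gf m X (sigma ++ [:: a; b] ++ tau) (sb ++ [:: 1] ++ tb)
    - chain_gf m X (sigma ++ [:: a.+1; b.-1] ++ tau) (sb ++ [:: 1] ++ tb))%R.
Proof.
move=> b2 ba.
(* Full overlap [b] makes the long row [a + b - b + 1 = a + 1]. *)
have hD := @skew_sum_overlap sigma sb a b b tau tb a.+1 b.-1 cS cT
  ltac:(lia) ltac:(lia) erefl.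
have ht := @standing_merge sigma sb a.+1 b.-1 cS ltac:(lia).
apply: skew_sum_ext (skew_sumD hD ht) => R m X /=.
rewrite !(chain_gf_join _ _ cS cT); try lia.
(* The merged rows of the two shapes have equal length and cancel. *)
have -> : a.+1 + b.-1 = a + b by lia.
ring.
Qed.

Section EqualRows.
Variable a : nat.
Hypothesis a2 : 2 <= a.

Let M k := nseq k a ++ tau.
Let bM k := nseq k 1 ++ tb.
Let P j := sigma ++ a.+1 :: nseq j a.
Let bP j := sb ++ nseq j.+1 1.

Let cM k : right_ctx (M k) (bM k).
Proof. by elim: k => [|k IH] //; apply: right_ctx_cons; last exact: IH; lia. Qed.

Let nseqSr (x : nat) j : nseq j.+1 x = nseq j x ++ [:: x].
Proof. by elim: j => //= j ->. Qed.

Let PS j : P j.+1 = P j ++ [:: a].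
Proof. by rewrite /P nseqSr -catA. Qed.

Let bPS j : bP j.+1 = bP j ++ [:: 1].
Proof. by rewrite /bP [nseq j.+2 1]nseqSr catA. Qed.

Let cP j : left_ctx (P j) (bP j).
Proof.
elim: j => [|j IH]; first by apply: left_ctx_rcons.
by rewrite PS bPS; apply: left_ctx_rcons => //; lia.
Qed.

Let left_nil : left_ctx [::] [::]. Proof. by []. Qed.
Let right_nil : right_ctx [::] [::]. Proof. by []. Qed.

Section Instance.
Local Open Scope ring_scope.
Variables (R : comNzRingType) (m : nat) (X : nat -> R).

Definition row_gf v : R := chain_gf m X [:: v] [::].
Definition left_gf v : R := chain_gf m X (sigma ++ [:: v]) sb.
Definition right_gf k v : R := chain_gf m X (v :: M k) (bM k).
Definition full_gf k v : R := chain_gf m X (sigma ++ v :: M k) (sb ++ bM k).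
Definition left_gf' j v : R := chain_gf m X (P j ++ [:: v]) (bP j).
Definition full_gf' j k v : R := chain_gf m X (P j ++ v :: M k) (bP j ++ bM k).

Let a0 : (0 < a)%N. Proof. by lia. Qed.

Let TS k v : (0 < v)%N -> right_gf k.+1 v = row_gf v * right_gf k a - right_gf k (a + v)%N.
Proof. by move=> v0; have /= := chain_gf_join m X left_nil (cM k) v0 a0; rewrite addnC. Qed.

Let JS k v : (0 < v)%N -> full_gf k.+1 v = left_gf v * right_gf k a - full_gf k (a + v)%N.
Proof. by move=> v0; have := chain_gf_join m X cS (cM k) v0 a0; rewrite addnC. Qed.

Let S'0 v : (0 < v)%N -> left_gf' 0 v = left_gf a.+1 * row_gf v - left_gf (a.+1 + v)%N.
Proof.
move=> v0; have := @chain_gf_join _ m X _ _ a.+1 _ _ _ cS right_nil isT v0.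
by rewrite /left_gf' /P /bP -catA cats0.
Qed.

Let S'S j v : (0 < v)%N -> left_gf' j.+1 v = left_gf' j a * row_gf v - left_gf' j (a + v)%N.
Proof.
move=> v0; have := chain_gf_join m X (cP j) right_nil a0 v0.
by rewrite /left_gf' PS bPS -catA cats0.
Qed.

Let J'0 k v : (0 < v)%N ->
  full_gf' 0 k v = left_gf a.+1 * right_gf k v - full_gf k (a.+1 + v)%N.
Proof.
move=> v0; have := @chain_gf_join _ m X _ _ a.+1 _ _ _ cS (cM k) isT v0.
by rewrite /full_gf' /P /bP -!catA.
Qed.

Let J'Sl j k v : (0 < v)%N ->
  full_gf' j.+1 k v = left_gf' j a * right_gf k v - full_gf' j k (a + v)%N.
Proof.
move=> v0; have := chain_gf_join m X (cP j) (cM k) a0 v0.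
by rewrite /full_gf' /left_gf' PS bPS -!catA.
Qed.

Let J'Sr j k v : (0 < v)%N ->
  full_gf' j k.+1 v = left_gf' j v * right_gf k a - full_gf' j k (a + v)%N.
Proof. by move=> v0; have := chain_gf_join m X (cP j) (cM k) v0 a0; rewrite addnC. Qed.

Definition defect_gf k c : R := shift_defect left_gf right_gf left_gf' k c.

Definition defect_gfE := shift_defectE JS J'0 J'Sl J'Sr a2.
Definition defect_gf0 c : defect_gf 0 c = _ := @shift_defect0 R row_gf left_gf right_gf full_gf left_gf' c.
Definition defect_gf1 := shift_defect1 TS JS S'0 J'0.
Definition defect_gfS := shift_defectS TS JS S'0 S'S J'0 J'Sl J'Sr a2.
End Instance.

(** Induction in steps of two, for all [c] at once: the recursion lowers [k] by 2 and replaces [c]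
    by [a + c]. *)
Lemma skew_sum_defect k c : 1 < c -> skew_sum (fun R m X => defect_gf m X k c).
Proof.
have diag k' c' : 1 < c' -> skew_sum (fun R m X =>
    left_gf m X c' * right_gf m X k' c' - full_gf m X k' c'.+1 * row_gf m X c'.-1)%R.
  move=> c1; apply: (skew_sum_overlap (o := c') cS (cM k')) => //; lia.
(* Overlap [c' + 1] fits into the row [a + c' - 1] because [a >= 2]. *)
have off k' c' : 1 < c' -> skew_sum (fun R m X =>
    left_gf m X c'.+1 * right_gf m X k' (a + c').-1
    - full_gf m X k' (a + c') * row_gf m X c')%R.
  move=> c1; apply: (skew_sum_overlap (o := c'.+1) cS (cM k')) => //; lia.
have mrg' j u v : 0 < v < u -> skew_sum (fun R m X =>
    full_gf' m X j 0 u * row_gf m X v - left_gf' m X j u * right_gf m X 0 v)%R.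
  by move=> uv; apply: standing_merge.
have mrg u v : 0 < v < u -> skew_sum (fun R m X =>
    full_gf m X 0 u * row_gf m X v - left_gf m X u * right_gf m X 0 v)%R.
  by move=> uv; apply: standing_merge.
suff : (forall c, 1 < c -> skew_sum (fun R m X => defect_gf m X k c)) /\
       (forall c, 1 < c -> skew_sum (fun R m X => defect_gf m X k.+1 c)) by case=> + _; apply.
elim: k => [|k [IH IH1]]; split=> // {}c c1.
- have h := skew_sumD (diag 0 c c1) (mrg c.+1 c.-1 ltac:(lia)).
  by apply: skew_sum_ext h => R m X; rewrite defect_gf0.
- have h := skew_sumD (skew_sumD (skew_sumD (diag 1 c c1) (off 0 c c1))
    (mrg (a + c) c ltac:(lia))) (mrg' 0 c c.-1 ltac:(lia)).
  by apply: skew_sum_ext h => R m X; rewrite /defect_gf defect_gf1.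
have h := skew_sumD (skew_sumD (skew_sumD (skew_sumD (diag k.+2 c c1) (off k.+1 c c1))
  (mrg' k.+1 c c.-1 ltac:(lia))) (mrg' k (a + c).-1 c ltac:(lia))) (IH (a + c) ltac:(lia)).
by apply: skew_sum_ext h => R m X; rewrite /defect_gf defect_gfS.
Qed.

Lemma skew_sum_equal_rows n : 2 <= n ->
  skew_sum (fun R m X => chain_gf m X (sigma ++ nseq n a ++ tau) (sb ++ nseq n.-1 1 ++ tb)
    - chain_gf m X (sigma ++ [:: a.+1] ++ nseq (n - 2) a ++ [:: a.-1] ++ tau)
        (sb ++ nseq n.-1 1 ++ tb))%R.
Proof.
case: n => [|[|n]] // _; rewrite subSS subSS subn0.
apply: skew_sum_ext (skew_sum_defect n a2) => R m X.
by rewrite /defect_gf defect_gfE /full_gf /full_gf' /P /bP -!catA /=.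
Qed.

End EqualRows.
End Main.

(** * Tableaux as interlacing patterns *)

Lemma mem_fillings m ls T :
  (T \in fillings m ls) = [&& size T == size ls,
    all (fun i => size (nth [::] T i) == nth 0 ls i) (iota 0 (size ls)) &
    all (all (fun x => x < m)) T].
Proof.
elim: ls T => [|l ls IH] T /=; first by rewrite inE; case: T.
apply/allpairsP/idP => [[[r T'] [/=]]|].
  rewrite mem_words IH => /andP[sr ar] /and3P[/eqP sT aT lT] -> /=.
  by rewrite sT eqxx sr ar lT -[1]/(1 + 0) iotaDl all_map aT.
case: T => [|r T] //= /and3P[/eqP[sT] /andP[sr aT] /andP[ar lT]]; exists (r, T).
rewrite /= mem_words IH sr ar sT eqxx lT; split=> //.
by move: aT; rewrite -[1]/(1 + 0) iotaDl all_map => ->.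
Qed.

Lemma uniq_fillings m ls : uniq (fillings m ls).
Proof.
elim: ls => //= l ls IH; apply: allpairs_uniq => //; first exact: uniq_words.
by move=> [x w] [y v] _ _ /= [-> ->].
Qed.

Definition ssyts (m : nat) (sh : seq nat * seq nat) : seq (seq (seq nat)) :=
  [seq T <- fillings m (row_lengths sh) | is_ssyt sh T].

Lemma uniq_ssyts m sh : uniq (ssyts m sh).
Proof. exact/filter_uniq/uniq_fillings. Qed.

(** In a sorted row the entries below [k] form a prefix. *)
Lemma count_lt_nth r t k : sorted leq r -> t < size r ->
  (nth 0 r t < k) = (t < count (fun x => x < k) r).
Proof.
elim: r t => [|x r IH] t //= pr.
have sr : sorted leq r by apply: path_sorted pr.
have [xk|kx] := ltnP x k; last first.
  have -> : count (fun x => x < k) r = 0.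
    apply/eqP; rewrite -leqn0 leqNgt -has_count -all_predC.
    apply: sub_all (order_path_min leq_trans pr) => y /= xy.
    by rewrite -leqNgt (leq_trans kx).
  case: t => [|t] /= tr; first by rewrite ltnNge kx.
  have := order_path_min leq_trans pr => /allP /(_ _ (mem_nth 0 tr)) h.
  by rewrite ltnNge (leq_trans kx h).
by case: t => [|t] //= tr; rewrite IH.
Qed.

Lemma count_ltS r k :
  count (fun x => x < k.+1) r = count (fun x => x < k) r + count_mem k r.
Proof. elim: r => //= x r ->; rewrite ltnS leq_eqVlt; case: ltngtP => //= _; lia. Qed.

Lemma count_lt_all m r k : all (fun x => x < m) r -> m <= k -> count (fun x => x < k) r = size r.
Proof.
move=> ar mk; apply/eqP; rewrite -all_count; apply: sub_all ar => x xm.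
exact: leq_trans mk.
Qed.

Definition row_of (m : nat) (c : nat -> nat) : seq nat :=
  flatten [seq nseq (c k) k | k <- iota 0 m].

Lemma count_row_of m c a : count a (row_of m c) = \sum_(0 <= k < m) a k * c k.
Proof.
rewrite count_flatten sumnE -map_comp big_map /index_iota subn0.
by apply: eq_bigr => k _; rewrite /= count_nseq.
Qed.

Lemma row_of_sorted m c : sorted leq (row_of m c).
Proof.
rewrite /row_of; move: {1}0 => b.
suff h n b' : b <= b' -> path leq b (flatten [seq nseq (c k) k | k <- iota b' n]).
  exact: path_sorted (h m b (leqnn b)).
elim: n b b' => //= n IH b b' bb.
rewrite cat_path; apply/andP; split.
  by elim: (c b') b bb => //= l IHl b bb; rewrite bb IHl.
apply: IH; elim: (c b') b bb => //= [b|l IHl b] bb; first exact: leqW.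
exact: IHl.
Qed.

Lemma mem_row_of m c x : x \in row_of m c -> x < m.
Proof. by move=> /flattenP[s /mapP[k]]; rewrite mem_iota add0n => km -> /nseqP[-> _]. Qed.

Section Patterns.
Variables (lam mu : seq nat).
Let L := size lam.

Hypothesis le_mu_lam : forall i, i < L -> nth 0 mu i <= nth 0 lam i.
Hypothesis mu_dec : forall i, i.+1 < L -> nth 0 mu i.+1 <= nth 0 mu i.
Hypothesis lam_dec : forall i, i.+1 < L -> nth 0 lam i.+1 <= nth 0 lam i.

(* A tableau is encoded by the chain of shapes [tau k] occupied by its letters
   [< k]; column strictness becomes interlacing of consecutive shapes. *)
Definition pattern_of (T : seq (seq nat)) (k i : nat) : nat :=
  nth 0 mu i + count (fun x => x < k) (nth [::] T i).

Definition tableau_of (m : nat) (tau : nat -> nat -> nat) : seq (seq nat) :=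
  mkseq (fun i => row_of m (fun k => tau k.+1 i - tau k i)) L.

(** The shapes stay at [lam] from [m] on, so the two inequalities can be asked for all [k]. *)
Definition pattern (m : nat) (tau : nat -> nat -> nat) : Prop :=
  [/\ forall i, i < L -> tau 0 i = nth 0 mu i,
      forall k i, m <= k -> i < L -> tau k i = nth 0 lam i,
      forall k i, i < L -> tau k i <= tau k.+1 i &
      forall k i, i.+1 < L -> tau k.+1 i.+1 <= tau k i].

Lemma mem_ssyts m T : (T \in ssyts m (lam, mu)) =
  [&& size T == L, all (all (fun x => x < m)) T, all (sorted leq) T,
    all (fun i => size (nth [::] T i) == nth 0 lam i - nth 0 mu i) (iota 0 L) &
    is_ssyt (lam, mu) T].
Proof.
rewrite mem_filter mem_fillings /row_lengths /= size_map size_iota -/L.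
have -> : all (fun i => size (nth [::] T i)
      == nth 0 [seq nth 0 lam j - nth 0 mu j | j <- iota 0 L] i) (iota 0 L)
    = all (fun i => size (nth [::] T i) == nth 0 lam i - nth 0 mu i) (iota 0 L).
  apply: eq_in_all => i; rewrite mem_iota => iL.
  by rewrite (nth_map 0) ?size_iota // nth_iota.
rewrite /is_ssyt /= -/L.
apply/and4P/and5P => [[/and4P[h1 h2 h3 h4] h5 h6 h7]|[h1 h2 h3 h4 /and4P[h5 h6 h7 h8]]].
  by split=> //; apply/and4P.
by split=> //; apply/and4P.
Qed.

Lemma ssyts_pattern m T : T \in ssyts m (lam, mu) ->
  pattern m (pattern_of T) /\ tableau_of m (pattern_of T) = T.
Proof.
rewrite mem_ssyts => /and5P[/eqP sT lT oT zT /and4P[_ _ _ cT]].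
have szT i : i < L -> size (nth [::] T i) = nth 0 lam i - nth 0 mu i.
  by move=> iL; apply/eqP/(allP zT); rewrite mem_iota.
have ltT i : i < L -> all (fun x => x < m) (nth [::] T i).
  by move=> iL; apply: (allP lT); rewrite mem_nth // sT.
have srT i : i < L -> sorted leq (nth [::] T i).
  by move=> iL; apply: (allP oT); rewrite mem_nth // sT.
split; last first.
  apply: (@eq_from_nth _ [::]); rewrite size_mkseq // => i iL.
  rewrite nth_mkseq //; apply: (sorted_eq leq_trans anti_leq) => //; first exact: row_of_sorted.
    exact: srT.
  apply/allP => x _ /=; apply/eqP; rewrite count_row_of.
  have e k : pattern_of T k.+1 i - pattern_of T k i = count_mem k (nth [::] T i).
    by rewrite /pattern_of subnDl count_ltS addKn.
  under eq_bigr => k _ do rewrite e.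
  have [xm|mx] := ltnP x m.
    rewrite (big_cat_nat _ (n := x)) // ?(ltnW xm) //= (big_ltn xm) /= eqxx mul1n.
    rewrite big_nat big1 => [|k kx]; last by rewrite /= (_ : (k == x) = false) //; lia.
    rewrite big_nat big1 => [|k kx]; last by rewrite /= (_ : (k == x) = false) //; lia.
    by rewrite addn0.
  rewrite big_nat big1 => [|k kx]; last by rewrite /= (_ : (k == x) = false) //; lia.
  symmetry; apply/eqP; rewrite -leqn0 leqNgt -has_count -all_predC.
  by apply: sub_all (ltT i iL) => y /= ym; apply/eqP; lia.
split.
- by move=> i iL; rewrite /pattern_of (eq_count (a2 := pred0)) // count_pred0 addn0.
- move=> k i mk iL; rewrite /pattern_of (count_lt_all (ltT i iL) mk) szT //.
  exact/subnKC/le_mu_lam.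
- by move=> k i iL; rewrite leq_add2l; apply: sub_count => x /= /ltnW.
move=> k i iL; have iL' := ltnW iL; rewrite leqNgt; apply/negP => lt_t.
(* In column [j] row [i] has a letter [>= k] and row [i + 1] a letter [<= k], against column
   strictness. *)
set j := pattern_of T k i in lt_t.
have ji : nth 0 mu i <= j by apply: leq_addr.
have ji1 : nth 0 mu i.+1 <= j by apply: leq_trans (mu_dec iL) ji.
have lamE i' : i' < L -> nth 0 lam i' = nth 0 mu i' + size (nth [::] T i').
  by move=> i'L; rewrite szT // subnKC // le_mu_lam.
have jl1 : j < nth 0 lam i.+1.
  by apply: leq_trans lt_t _; rewrite lamE // leq_add2l count_size.
have jl : j < nth 0 lam i by apply: leq_trans jl1 (lam_dec iL).
have /allP /(_ i) := cT; rewrite mem_iota add0n ltn_predRL => /(_ iL) /allP /(_ j).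
rewrite mem_iota ji jl ji1 jl1 => /(_ isT) /=; apply/negP; rewrite -leqNgt.
have szi : j - nth 0 mu i < size (nth [::] T i) by rewrite szT //; lia.
have szi1 : j - nth 0 mu i.+1 < size (nth [::] T i.+1) by rewrite szT //; lia.
have h1 : k <= nth 0 (nth [::] T i) (j - nth 0 mu i).
  by rewrite leqNgt count_lt_nth ?srT // /j /pattern_of addKn ltnn.
apply: leq_trans h1; rewrite -ltnS count_lt_nth ?srT // ltn_subLR //.
Qed.

Lemma pattern_ssyts m tau : pattern m tau ->
  tableau_of m tau \in ssyts m (lam, mu) /\
  forall k i, i < L -> pattern_of (tableau_of m tau) k i = tau k i.
Proof.
move=> [t0 tm tS tI].
have tle i k k' : i < L -> k <= k' -> tau k i <= tau k' i.
  by move=> iL; elim: k' => [|k' IH] kk; [move: kk; rewrite leqn0 => /eqP->|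
     move: kk; rewrite leq_eqVlt => /predU1P[->//|/IH h]; apply: leq_trans h (tS _ _ iL)].
have sumE i k : i < L -> \sum_(0 <= j < k) (tau j.+1 i - tau j i) = tau k i - tau 0 i.
  by move=> iL; rewrite telescope_sumn_in // => a b *; apply: tle.
have cE i k : i < L -> count (fun x => x < k) (row_of m (fun k => tau k.+1 i - tau k i))
    = tau k i - tau 0 i.
  move=> iL; rewrite count_row_of; have [km|mk] := leqP k m.
    rewrite (big_cat_nat _ (n := k)) //= addnC big_nat big1 ?add0n => [|j jk]; last first.
      by rewrite ltnNge; case/andP: jk => ->.
    by rewrite -sumE // big_nat [RHS]big_nat; apply: eq_bigr => j /= ->; rewrite mul1n.
  rewrite tm // 1?ltnW // -(tm m i) // -sumE // big_nat [RHS]big_nat.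
  by apply: eq_bigr => j /= jm; rewrite (ltn_trans jm mk) mul1n.
have pE k i : i < L -> pattern_of (tableau_of m tau) k i = tau k i.
  by move=> iL; rewrite /pattern_of nth_mkseq // cE // -t0 // subnKC // tle.
split=> //; rewrite mem_ssyts.
have zT i : i < L -> size (row_of m (fun k => tau k.+1 i - tau k i)) = nth 0 lam i - nth 0 mu i.
  have ltm : all (fun x => x < m) (row_of m (fun k => tau k.+1 i - tau k i)).
    by apply/allP => x; apply: mem_row_of.
  by move=> iL; rewrite -(count_lt_all ltm (leqnn m)) cE // tm // t0.
have h1 : all (all (fun x => x < m)) (tableau_of m tau).
  by apply/allP => r /mapP[i _ ->]; apply/allP => x; apply: mem_row_of.
have h2 : all (sorted leq) (tableau_of m tau).
  by apply/allP => r /mapP[i _ ->]; apply: row_of_sorted.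
have h3 : all (fun i => size (nth [::] (tableau_of m tau) i) == nth 0 lam i - nth 0 mu i) (iota 0 L).
  by apply/allP => i; rewrite mem_iota => /= iL; rewrite nth_mkseq // zT.
rewrite h1 h2 h3 /is_ssyt size_mkseq eqxx h2 h3 /=.
apply/allP => i; rewrite mem_iota add0n => /= iL1.
have iL : i.+1 < L by rewrite -ltn_predRL.
have iL' := ltnW iL.
apply/allP => j _; apply/implyP => /andP[/andP[ji jl] /andP[ji1 jl1]].
rewrite !nth_mkseq //.
set x := row_of m _; set w := row_of m _.
have szx : j - nth 0 mu i < size x by rewrite zT //; lia.
have szw : j - nth 0 mu i.+1 < size w by rewrite zT //; lia.
set y := nth 0 w _.
rewrite count_lt_nth ?row_of_sorted // cE // t0 //.
have := count_lt_nth y.+1 (row_of_sorted m (fun k => tau k.+1 i.+1 - tau k i.+1)) szw.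
rewrite -/w -/y ltnSn cE // t0 // => /esym.
(* The cell holding [y] lies in the shape of the letters [< y + 1]; by interlacing the cell above it
   lies in the shape of the letters [< y]. *)
have := tI y i iL; have := tle i 0 y iL' isT; have := tle i.+1 0 y.+1 iL isT.
rewrite !t0 //; lia.
Qed.
End Patterns.

(** * Bender-Knuth involutions *)

Section BenderKnuth.
Variables (lam mu : seq nat) (m : nat).
Let L := size lam.

(* [colsum tau k j] is the number of letters [< k] in columns [>= j], up to
   a constant depending only on [mu] and [j]. *)
Definition colsum (tau : nat -> nat -> nat) (k j : nat) : nat :=
  \sum_(0 <= i < L) (tau k i - j).

(** Together with [bk_hi], the range in which row [i] of shape [k + 1] can end while the shapes [k]
    and [k + 2] stay fixed. *)
Definition bk_lo (tau : nat -> nat -> nat) k i : nat :=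
  if i.+1 < L then maxn (tau k i) (tau k.+2 i.+1) else tau k i.
Definition bk_hi (tau : nat -> nat -> nat) k i : nat :=
  if 0 < i then minn (tau k.+2 i) (tau k i.-1) else tau k.+2 i.

(* The Bender-Knuth involution on the letters [k] and [k + 1] in the columns [< j]. *)
Definition bk (k j : nat) (tau : nat -> nat -> nat) (k' i : nat) : nat :=
  if k' == k.+1 then
    if j < tau k.+1 i then tau k.+1 i
    else bk_lo tau k i + minn (bk_hi tau k i) j - tau k.+1 i
  else tau k' i.

Lemma bk_other k j tau k' : k' != k.+1 -> bk k j tau k' =1 tau k'.
Proof. by move=> /negbTE kk i; rewrite /bk kk. Qed.

Lemma bk_below k j tau : bk k j tau k =1 tau k.
Proof. by apply: bk_other; rewrite neq_ltn ltnSn. Qed.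
Lemma bk_above k j tau : bk k j tau k.+2 =1 tau k.+2.
Proof. by apply: bk_other; rewrite neq_ltn ltnSn orbT. Qed.

Lemma bk_loE k j tau : bk_lo (bk k j tau) k =1 bk_lo tau k.
Proof. by move=> i; rewrite /bk_lo bk_below !bk_above. Qed.
Lemma bk_hiE k j tau : bk_hi (bk k j tau) k =1 bk_hi tau k.
Proof. by move=> i; rewrite /bk_hi !bk_below bk_above. Qed.

Section OnPattern.
Variables (tau : nat -> nat -> nat) (k j : nat).
Hypothesis ptau : pattern lam mu m tau.

Lemma bk_bounds i : i < L -> bk_lo tau k i <= tau k.+1 i <= bk_hi tau k i.
Proof.
case: ptau => _ _ tS tI iL; rewrite /bk_lo /bk_hi.
have h1 := tS k i iL; have h2 := tS k.+1 i iL.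
apply/andP; split.
  by case: ifP => // iL1; rewrite geq_max h1 tI.
by case: ifP => // i0; rewrite leq_min h2 /=; case: i iL i0 {h1 h2} => //= i iL _; apply: tI.
Qed.

Lemma bk_between i : i < L -> bk_lo tau k i <= bk k j tau k.+1 i <= bk_hi tau k i.
Proof. by move=> iL; have := bk_bounds iL; rewrite /bk eqxx; case: ifP; lia. Qed.

(** A row ending at most at [j] is reflected in the interval from [bk_lo] to [min(bk_hi, j)], so it
    stays at most [j] and is reflected back; longer rows never move. *)
Lemma bk_involutive i : i < L -> bk k j (bk k j tau) k.+1 i = tau k.+1 i.
Proof.
move=> iL; have := bk_bounds iL; rewrite {1}/bk eqxx bk_loE bk_hiE {1 2 3}/bk eqxx.
by case: ifP; case: ifP; lia.
Qed.

Lemma bk_pattern : k.+1 < m -> pattern lam mu m (bk k j tau).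
Proof.
move=> km; have [t0 tm tS tI] := ptau; split.
- by move=> i iL; rewrite bk_other // t0.
- by move=> k' i mk iL; rewrite bk_other ?tm //; apply/eqP; lia.
- move=> k' i iL; have hb := bk_between iL.
  have hlo : tau k i <= bk_lo tau k i by rewrite /bk_lo; case: ifP => // _; rewrite leq_maxl.
  have hhi : bk_hi tau k i <= tau k.+2 i by rewrite /bk_hi; case: ifP => // _; rewrite geq_minl.
  have [->|ne1] := eqVneq k' k.+1.
    by rewrite bk_above; move: hb; lia.
  have [ek|ne2] := eqVneq k'.+1 k.+1; last by rewrite !bk_other ?tS //.
  have {ek} -> : k' = k by lia.
  by rewrite bk_below; move: hb; lia.
move=> k' i iL; have [ek|ne1] := eqVneq k' k.+1.
  rewrite ek bk_above.
  by have := bk_between (ltnW iL); rewrite /bk_lo iL; lia.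
have [ek|ne2] := eqVneq k'.+1 k.+1; last by rewrite !bk_other ?tI //.
have {ek ne1} -> : k' = k by lia.
rewrite bk_below.
by have := bk_between iL; rewrite /bk_hi /=; lia.
Qed.

Lemma bk_colsum k' j' : j <= j' -> colsum (bk k j tau) k' j' = colsum tau k' j'.
Proof.
move=> jj; rewrite /colsum !big_nat; apply: eq_bigr => i /= iL.
have [->|ne] := eqVneq k' k.+1; last by rewrite bk_other.
by have := bk_bounds iL; rewrite /bk eqxx; case: ifP; lia.
Qed.

(* The hypothesis holds as soon as column [j] contains no letter [k]. *)
Lemma bk_weight : (forall i, i < L -> j < tau k.+1 i -> j <= tau k i) ->
  colsum (bk k j tau) k.+1 0 + colsum tau k.+1 0 + colsum tau k j + colsum tau k.+2 j
  = colsum tau k 0 + colsum tau k.+2 0 + (colsum tau k.+1 j).*2.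
Proof.
move=> colj.
have e1 : colsum (bk k j tau) k.+1 0 + colsum tau k.+1 0 =
    \sum_(0 <= i < L) minn (bk_lo tau k i) j + \sum_(0 <= i < L) minn (bk_hi tau k i) j
    + (colsum tau k.+1 j).*2.
  rewrite -addnn /colsum -!big_split /= !big_nat; apply: eq_bigr => i /= iL.
  have := bk_bounds iL; rewrite /bk eqxx !subn0; case: ltnP => [h|]; last lia.
  have : tau k i <= bk_lo tau k i by rewrite /bk_lo; case: ifP => // _; rewrite leq_maxl.
  by have := colj i iL h; lia.
(* The lower bound of row [i] and the upper bound of row [i + 1] are the maximum and minimum of the
   same two numbers, so their sum is preserved. *)
have e2 : \sum_(0 <= i < L) minn (bk_lo tau k i) j + \sum_(0 <= i < L) minn (bk_hi tau k i) j
    = \sum_(0 <= i < L) minn (tau k i) j + \sum_(0 <= i < L) minn (tau k.+2 i) j.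
  rewrite /bk_lo /bk_hi; case: L => [|n]; first by rewrite !big_geq.
  rewrite big_nat_recr //= [X in _ + X]big_nat_recl //=.
  rewrite [X in _ = X + _]big_nat_recr //= [X in _ = _ + X]big_nat_recl //=.
  rewrite ltnn.
  have -> : \sum_(0 <= i < n) minn (if i.+1 < n.+1 then maxn (tau k i) (tau k.+2 i.+1)
        else tau k i) j
      = \sum_(0 <= i < n) minn (maxn (tau k i) (tau k.+2 i.+1)) j.
    by rewrite !big_nat; apply: eq_bigr => i /= iN; rewrite ltnS iN.
  suff : \sum_(0 <= i < n) minn (maxn (tau k i) (tau k.+2 i.+1)) j
     + \sum_(0 <= i < n) minn (minn (tau k.+2 i.+1) (tau k i)) j
     = \sum_(0 <= i < n) minn (tau k i) j + \sum_(0 <= i < n) minn (tau k.+2 i.+1) j by lia.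
  by rewrite -!big_split /=; apply: eq_bigr => i _; lia.
have e3 k' : \sum_(0 <= i < L) minn (tau k' i) j + colsum tau k' j = colsum tau k' 0.
  by rewrite /colsum -big_split /=; apply: eq_bigr => i _; lia.
by rewrite e1 e2 -!(e3 k) -!(e3 k.+2); lia.
Qed.

End OnPattern.

(* [tau] is Yamanouchi when, for all [k] and [j], the columns [>= j] contain at
   least as many letters [k] as letters [k + 1]; [unbalanced] is the failure. *)
Definition unbalanced (tau : nat -> nat -> nat) (k j : nat) : bool :=
  (colsum tau k.+1 j).*2 < colsum tau k.+2 j + colsum tau k j.

Section Column.
Variables (tau : nat -> nat -> nat) (k j : nat).
Hypothesis ptau : pattern lam mu m tau.

Let rowsum k' := \sum_(0 <= i < L) (j < tau k' i).

Let colsumS k' : colsum tau k' j = colsum tau k' j.+1 + rowsum k'.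
Proof. by rewrite /colsum /rowsum -big_split /=; apply: eq_bigr => i _; lia. Qed.

Let rowsumS k' : rowsum k' <= rowsum k'.+1 <= (rowsum k').+1.
Proof.
have [_ _ tS tI] := ptau; apply/andP; split.
  rewrite /rowsum !big_nat; apply: leq_sum => i /= iL.
  by have := tS k' i iL; case: (ltnP j (tau k' i)) => //; lia.
rewrite /rowsum /L; case: (size lam) tS tI => [|n] tS tI; first by rewrite !big_geq.
rewrite [X in X <= _]big_nat_recl //= [X in _ <= X.+1]big_nat_recr //=.
have : \sum_(0 <= i < n) (j < tau k'.+1 i.+1) <= \sum_(0 <= i < n) (j < tau k' i).
  rewrite !big_nat; apply: leq_sum => i /= iL.
  by have := tI k' i iL; case: (ltnP j (tau k'.+1 i.+1)) => //; lia.
by case: (j < tau k'.+1 0); lia.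
Qed.

(** A column holds each letter at most once. If balance is lost on adding column [j], that column
    holds [k + 1] but not [k], and the excess is exactly one. *)
Lemma unbalanced_column : unbalanced tau k j -> ~~ unbalanced tau k j.+1 ->
  colsum tau k.+2 j + colsum tau k j = (colsum tau k.+1 j).*2.+1 /\
  forall i, i < L -> j < tau k.+1 i -> j <= tau k i.
Proof.
rewrite /unbalanced !colsumS => h1 h2.
have [r1 r2] := (rowsumS k, rowsumS k.+1).
have er : rowsum k.+1 = rowsum k by lia.
split; first lia.
have [_ _ tS _] := ptau.
move=> i iL jt; rewrite leqNgt; apply/negP => tj.
have : rowsum k < rowsum k.+1; last by rewrite er ltnn.
rewrite /rowsum !big_mkord (bigD1 (Ordinal iL)) //= [X in _ < X](bigD1 (Ordinal iL)) //=.
have -> : (j < tau k i) = false by rewrite ltnNge ltnW.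
rewrite jt /= add0n add1n ltnS; apply: leq_sum => i' _.
by have := tS k i' (ltn_ord i'); case: (ltnP j (tau k i')) => //; lia.
Qed.

End Column.
End BenderKnuth.

(** * Weights of tableaux and the symmetry of skew Schur functions *)

Definition weight (m : nat) (T : seq (seq nat)) : 'X_{1..m} :=
  [multinom count_mem (k : nat) (flatten T) | k < m].

Definition mnm_perm (m : nat) (s : 'S_m) (w : 'X_{1..m}) : 'X_{1..m} := [multinom w (s i) | i < m].

Definition delta (m : nat) : 'X_{1..m} := [multinom (m - i.+1)%N | i < m].

Lemma pattern_le_lam lam mu m tau k i : pattern lam mu m tau -> i < size lam ->
  tau k i <= nth 0 lam i.
Proof.
move=> [_ tm tS _] iL; rewrite -(tm (m + k) i) ?leq_addr //.
by elim: m {tm} => [|n IH] //; apply: leq_trans IH (tS _ _ iL).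
Qed.

Section Stembridge.
Variables (lam mu : seq nat).
Let L := size lam.
Let sh := (lam, mu).

Hypothesis le_mu_lam : forall i, i < L -> nth 0 mu i <= nth 0 lam i.
Hypothesis mu_dec : forall i, i.+1 < L -> nth 0 mu i.+1 <= nth 0 mu i.
Hypothesis lam_dec : forall i, i.+1 < L -> nth 0 lam i.+1 <= nth 0 lam i.

Section Tableaux.
Variable m : nat.

Let ssyts_pat T (h : T \in ssyts m sh) := (ssyts_pattern le_mu_lam mu_dec lam_dec h).1.
Let ssyts_id T (h : T \in ssyts m sh) := (ssyts_pattern le_mu_lam mu_dec lam_dec h).2.
Let pat_ssyts tau (h : pattern lam mu m tau) := (pattern_ssyts h).1.
Let pat_id tau (h : pattern lam mu m tau) := (pattern_ssyts h).2.

Lemma count_colsum T k : T \in ssyts m sh ->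
  count_mem k (flatten T) + colsum lam (pattern_of mu T) k 0
  = colsum lam (pattern_of mu T) k.+1 0.
Proof.
move=> /[dup] hT; rewrite mem_ssyts => /and5P[/eqP sT _ _ _ _].
rewrite count_flatten sumnE big_map (big_nth [::]) sT /colsum -big_split /=.
by apply: eq_bigr => i _; rewrite !subn0 /pattern_of count_ltS addnC addnA.
Qed.

Lemma tableau_of_eq tau tau' : (forall k i, i < L -> tau k i = tau' k i) ->
  tableau_of lam m tau = tableau_of lam m tau'.
Proof.
move=> e; apply: (@eq_from_nth _ [::]); rewrite !size_mkseq // => i iL.
rewrite !nth_mkseq //; congr flatten; apply: eq_map => k.
by rewrite !e.
Qed.

Lemma colsum_eq tau tau' k j : (forall k i, i < L -> tau k i = tau' k i) ->
  colsum lam tau k j = colsum lam tau' k j.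
Proof. by move=> e; rewrite /colsum !big_nat; apply: eq_bigr => i /= iL; rewrite e. Qed.

Lemma bk_eq k j tau tau' : (forall k i, i < L -> tau k i = tau' k i) ->
  forall k' i, i < L -> bk lam k j tau k' i = bk lam k j tau' k' i.
Proof.
move=> e k' i iL; have elo : bk_lo lam tau k i = bk_lo lam tau' k i.
  by rewrite /bk_lo; case: ifP => iL1; rewrite !e.
have ehi : bk_hi tau k i = bk_hi tau' k i.
  by rewrite /bk_hi; case: i iL {elo} => [|i] iL /=; rewrite !e // ltnW.
by rewrite /bk elo ehi !e.
Qed.

Definition bk_tableau k j T := tableau_of lam m (bk lam k j (pattern_of mu T)).

Lemma bk_tableauP k j T : k.+1 < m -> T \in ssyts m sh ->
  [/\ bk_tableau k j T \in ssyts m sh, bk_tableau k j (bk_tableau k j T) = T &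
    forall k' i, i < L -> pattern_of mu (bk_tableau k j T) k' i
      = bk lam k j (pattern_of mu T) k' i].
Proof.
move=> km hT; have p := ssyts_pat hT; have pb := bk_pattern j p km.
have e := pat_id pb; split=> //; first exact: pat_ssyts.
rewrite -[RHS](ssyts_id hT); apply: tableau_of_eq => k' i iL.
rewrite (bk_eq k j e) //; have [->|ne] := eqVneq k' k.+1; first exact: (bk_involutive k j p iL).
by rewrite !bk_other.
Qed.

Lemma weightE T (k : 'I_m) : T \in ssyts m sh ->
  weight m T k = colsum lam (pattern_of mu T) k.+1 0 - colsum lam (pattern_of mu T) k 0.
Proof. by move=> hT; rewrite mnmE -count_colsum // addnK. Qed.

(** [d] is the excess of letters [k + 1] over letters [k] in the columns [>= j], which stay fixed
    while the two counts are exchanged elsewhere. [d = 0] gives symmetry, [d = 1] the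
    cancellation. *)
Lemma bk_weight_tperm k j T (k0 k1 : 'I_m) (d : nat) : k0 = k :> nat -> k1 = k.+1 :> nat ->
  T \in ssyts m sh ->
  let tau := pattern_of mu T in
  (forall i, i < L -> j < tau k.+1 i -> j <= tau k i) ->
  colsum lam tau k.+2 j + colsum lam tau k j = (colsum lam tau k.+1 j).*2 + d ->
  weight m (bk_tableau k j T) k0 + d = weight m T k1 /\
  weight m (bk_tableau k j T) k1 = weight m T k0 + d /\
  forall i, i != k0 -> i != k1 -> weight m (bk_tableau k j T) i = weight m T i.
Proof.
move=> ek0 ek1 hT tau colj hd.
have km : k.+1 < m by rewrite -ek1.
have [hT' _ e] := bk_tableauP j km hT.
have p := ssyts_pat hT; have := bk_weight p colj; rewrite -/tau => bw.
have c' k' : colsum lam (pattern_of mu (bk_tableau k j T)) k' 0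
    = colsum lam (bk lam k j tau) k' 0 by apply: colsum_eq.
have co k' : k' != k.+1 -> colsum lam (bk lam k j tau) k' 0 = colsum lam tau k' 0.
  by move=> ne; rewrite /colsum; apply: eq_bigr => i _; rewrite bk_other.
have mono k' : colsum lam tau k' 0 <= colsum lam tau k'.+1 0 by rewrite -(count_colsum k' hT) leq_addl.
have mono' : colsum lam (bk lam k j tau) k 0 <= colsum lam (bk lam k j tau) k.+1 0.
  by rewrite -!c' -(count_colsum k hT') leq_addl.
have mono'' : colsum lam (bk lam k j tau) k.+1 0 <= colsum lam (bk lam k j tau) k.+2 0.
  by rewrite -!c' -(count_colsum k.+1 hT') leq_addl.
have ck : colsum lam (bk lam k j tau) k 0 = colsum lam tau k 0 by apply: co; lia.
have ck2 : colsum lam (bk lam k j tau) k.+2 0 = colsum lam tau k.+2 0 by apply: co; lia.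
have m0 := mono k; have m1 := mono k.+1.
rewrite !weightE // -/tau ek0 ek1 !c'.
split; first by lia.
split; first by lia.
move=> i n0 n1; rewrite !weightE // !c' -/tau !co //; move: n0 n1; rewrite -!(inj_eq val_inj) /=; lia.
Qed.

Section Invariance.
Variables (V : nmodType).

Lemma ssyts_tperm (phi : 'X_{1..m} -> V) (k0 k1 : 'I_m) : k1 = k0.+1 :> nat ->
  (\sum_(T <- ssyts m sh) phi (mnm_perm (tperm k0 k1) (weight m T))
   = \sum_(T <- ssyts m sh) phi (weight m T))%R.
Proof.
move=> ek; have km : k0.+1 < m by rewrite -ek.
(* No row extends beyond this column, so the involution acts on the whole tableau. *)
pose j := sumn lam.
have jlam i : i < L -> nth 0 lam i <= j.
  move=> iL; rewrite /j sumnE (big_nth 0) big_mkord (bigD1 (Ordinal iL)) //=.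
  exact: leq_addr.
have cj k T : T \in ssyts m sh -> colsum lam (pattern_of mu T) k j = 0.
  move=> hT; rewrite /colsum big_nat big1 // => i /= iL.
  apply/eqP; rewrite subn_eq0; apply: leq_trans (jlam i iL).
  exact: pattern_le_lam (ssyts_pat hT) iL.
apply: (@big_seq_bij _ _ _ _ _ (bk_tableau k0 j) (bk_tableau k0 j)); try exact: uniq_ssyts.
  move=> T hT; have [h1 h2 _] := bk_tableauP j km hT; split=> //; congr phi.
  have [] := @bk_weight_tperm k0 j T k0 k1 0 erefl ek hT _ _.
  - move=> i iL; have := pattern_le_lam k0.+1 (ssyts_pat hT) iL.
    by have := jlam i iL; lia.
  - by rewrite !cj.
  rewrite addn0 => w0 [w1 wo]; apply/mnmP => i; rewrite mnmE.
  case: tpermP => [->|->|n0 n1]; rewrite ?w0 // ?w1 ?addn0 // wo //; exact/eqP.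
by move=> T hT; have [h1 h2 _] := bk_tableauP j km hT.
Qed.

Lemma ssyts_perm (s : 'S_m) (phi : 'X_{1..m} -> V) :
  (\sum_(T <- ssyts m sh) phi (mnm_perm s (weight m T))
   = \sum_(T <- ssyts m sh) phi (weight m T))%R.
Proof.
have permM w s1 s2 : mnm_perm (s1 * s2)%g w = mnm_perm s1 (mnm_perm s2 w).
  by apply/mnmP => i; rewrite !mnmE permM.
pose inv s := forall phi : 'X_{1..m} -> V,
  (\sum_(T <- ssyts m sh) phi (mnm_perm s (weight m T))
   = \sum_(T <- ssyts m sh) phi (weight m T))%R.
have invM s1 s2 : inv s1 -> inv s2 -> inv (s1 * s2)%g.
  move=> i1 i2 f; under eq_bigr do rewrite permM.
  by rewrite (i2 (fun w => f (mnm_perm s1 w))) i1.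
have invT n (i j : 'I_m) : (i + n).+1 = j -> inv (tperm i j).
  elim: n i j => [|n IH] i j e; first by move=> f; apply: ssyts_tperm; lia.
  have lt_k : i + n < m by have := ltn_ord j; lia.
  have jm : (i + n).+1 < m by have := ltn_ord j; lia.
  pose k : 'I_m := Ordinal jm.
  (* Conjugation by the adjacent transposition of [j - 1] and [j] shortens the distance by one. *)
  have -> : tperm i j = (tperm k j * (tperm i k * tperm k j))%g.
    have -> : tperm i j = (tperm i k ^ tperm k j)%g.
      rewrite tpermJ tpermL tpermD //; apply/eqP => /(congr1 val) /=; lia.
    by rewrite conjgE tpermV mulgA.
  have ikj : inv (tperm k j) by move=> f; apply: ssyts_tperm => /=; lia.
  by apply: (invM) => //; apply: (invM) => //; apply: IH.
have [ts -> _] := prod_tpermP s.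
move: phi; rewrite -/(inv _); elim: ts => [|[i j] ts IH].
  move=> f; rewrite big_nil; apply: eq_bigr => T _; congr f.
  by apply/mnmP => i; rewrite mnmE perm1.
rewrite big_cons; apply: invM => //=.
have [lt|lt|e] := ltngtP i j.
- by apply: (invT (j - i).-1); lia.
- by rewrite tpermC; apply: (invT (i - j).-1); lia.
have -> : i = j by apply: val_inj.
move=> f; rewrite tperm1; apply: eq_bigr => T _; congr f.
by apply/mnmP => i'; rewrite mnmE perm1.
Qed.
End Invariance.
End Tableaux.
End Stembridge.

(** * Alternants and the Littlewood-Richardson rule *)

Section Alternants.
Local Open Scope ring_scope.
Variable m : nat.

Definition alternant (w : 'X_{1..m}) : {mpoly rat[m]} :=
  \sum_(s : 'S_m) (-1) ^+ s *: 'X_[mnm_perm s w].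

Lemma mnm_permD s (w w' : 'X_{1..m}) : mnm_perm s (w + w')%MM = (mnm_perm s w + mnm_perm s w')%MM.
Proof. by apply/mnmP => i; rewrite !mnmE. Qed.

Lemma alternant_tperm i j w : i != j -> alternant (mnm_perm (tperm i j) w) = - alternant w.
Proof.
move=> ij; rewrite /alternant (reindex_inj (mulIg (tperm i j))) -sumrN /=.
apply: eq_bigr => s _; rewrite -scaleNr odd_permM odd_tperm ij addbT.
have -> : mnm_perm (s * tperm i j)%g (mnm_perm (tperm i j) w) = mnm_perm s w.
  by apply/mnmP => i'; rewrite !mnmE permM tpermK.
by rewrite -signr_odd; case: (odd_perm s); rewrite /= ?expr0 ?expr1 ?opprK.
Qed.

(** The entries of [delta] are distinct, so only the identity contributes to the coefficient at
    [delta], which is 1. *)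
Lemma alternant_delta_neq0 : alternant (delta m) != 0.
Proof.
apply/eqP => /(congr1 (mcoeff (delta m))); rewrite mcoeff0 /alternant raddf_sum /=.
rewrite (bigD1 1%g) //= big1 ?addr0 => [|s s1].
  rewrite odd_perm1 expr0 scale1r mcoeffX.
  have -> : mnm_perm 1 (delta m) = delta m by apply/mnmP => i; rewrite !mnmE perm1.
  by rewrite eqxx; apply/eqP; rewrite oner_eq0.
rewrite mcoeffZ mcoeffX; case: eqP => [e|_]; last by rewrite mulr0.
case/eqP: s1; apply/permP => i; rewrite perm1; apply: val_inj.
have /mnmP /(_ i) := e; rewrite !mnmE /=.
by have := ltn_ord i; have := ltn_ord (s i); lia.
Qed.
End Alternants.

Definition skew_mpoly (m : nat) (sh : seq nat * seq nat) : {mpoly rat[m]} :=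
  (\sum_(T <- ssyts m sh) 'X_[weight m T])%R.

(** * Cancellation of the tableaux that are not Yamanouchi *)

Section Cancellation.
Variables (lam mu : seq nat).
Let L := size lam.
Let sh := (lam, mu).
Let N := sumn lam.

Hypothesis le_mu_lam : forall i, i < L -> nth 0 mu i <= nth 0 lam i.
Hypothesis mu_dec : forall i, i.+1 < L -> nth 0 mu i.+1 <= nth 0 mu i.
Hypothesis lam_dec : forall i, i.+1 < L -> nth 0 lam i.+1 <= nth 0 lam i.

Variable m : nat.

(** [d] counts columns from the right, so that [find] meets the rightmost one first. *)
Let bad_at tau d := has (fun k => unbalanced lam tau k (N - d)) (iota 0 m).

Definition yamanouchi (tau : nat -> nat -> nat) : bool := ~~ has (bad_at tau) (iota 0 N.+1).

(* The rightmost unbalanced column, and the first unbalanced letter there. *)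
Definition bad_column tau := N - find (bad_at tau) (iota 0 N.+1).
Definition bad_letter tau := find (fun k => unbalanced lam tau k (bad_column tau)) (iota 0 m).

Let lam_le i : i < L -> nth 0 lam i <= N.
Proof.
move=> iL; rewrite /N sumnE (big_nth 0) big_mkord (bigD1 (Ordinal iL)) //=.
exact: leq_addr.
Qed.

Let colsum_big tau k j : pattern lam mu m tau -> N <= j -> colsum lam tau k j = 0.
Proof.
move=> p Nj; rewrite /colsum big_nat big1 // => i /= iL; apply/eqP; rewrite subn_eq0.
exact: leq_trans (pattern_le_lam k p iL) (leq_trans (lam_le iL) Nj).
Qed.

Let balanced_big tau k j : pattern lam mu m tau -> (m <= k.+1) || (N <= j) -> ~~ unbalanced lam tau k j.
Proof.
move=> p /orP[mk|Nj]; last by rewrite /unbalanced !colsum_big.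
have [_ tm tS _] := p; rewrite -leqNgt -addnn leq_add //.
  by rewrite /colsum !big_nat; apply: leq_sum => i /= iL; rewrite !tm // ltnW.
by rewrite /colsum !big_nat; apply: leq_sum => i /= iL; apply: leq_sub2r; apply: tS.
Qed.

(** The finite search suffices: no letter [>= m] occurs and no column [>= N] is occupied. *)
Lemma yamanouchiP tau : pattern lam mu m tau ->
  reflect (forall k j, ~~ unbalanced lam tau k j) (yamanouchi tau).
Proof.
move=> p; apply: (iffP idP) => [y k j|h]; last first.
  by apply/hasPn => d _; apply/hasPn => k _.
have [big|] := boolP ((m <= k.+1) || (N <= j)); first exact: balanced_big.
rewrite negb_or => /andP[]; rewrite -ltnNge => km; rewrite -ltnNge => jN.
have /hasPn /(_ (N - j)) := y; rewrite mem_iota => /(_ ltac:(lia)) /hasPn /(_ k).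
have -> : N - (N - j) = j by lia.
by rewrite mem_iota; apply; lia.
Qed.

Lemma bad_spec tau (k := bad_letter tau) (j := bad_column tau) :
  pattern lam mu m tau -> ~~ yamanouchi tau ->
  [/\ k.+1 < m, unbalanced lam tau k j & ~~ unbalanced lam tau k j.+1].
Proof.
move=> p; rewrite negbK => hb.
have [h1 h2 h3] := find_iotaP (bad_at tau) N.+1.
have {}h3 : bad_at tau (find (bad_at tau) (iota 0 N.+1)).
  by apply: h3; rewrite -{2}(size_iota 0 N.+1) -has_find.
have ub : unbalanced lam tau k j.
  have := h3; rewrite /bad_at -/(bad_column tau) => hk.
  have [_ _ k3] := find_iotaP (fun k => unbalanced lam tau k (bad_column tau)) m.
  by apply: k3; rewrite -{2}(size_iota 0 m) -has_find.
have : ~~ ((m <= k.+1) || (N <= j)) by apply: contraL ub; apply: balanced_big.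
rewrite negb_or => /andP[]; rewrite -ltnNge => km; rewrite -ltnNge => jN; split=> //.
have d0 : 0 < find (bad_at tau) (iota 0 N.+1) by move: jN; rewrite /j /bad_column; lia.
have := h2 (find (bad_at tau) (iota 0 N.+1)).-1 ltac:(lia) => /hasPn /(_ k).
have -> : N - (find (bad_at tau) (iota 0 N.+1)).-1 = j.+1.
  have : find (bad_at tau) (iota 0 N.+1) < N.+1 by rewrite -{2}(size_iota 0 N.+1) -has_find.
  by move: d0; rewrite /j /bad_column; lia.
by rewrite mem_iota; apply; lia.
Qed.

(** The choice of column and letter depends only on the columns from the bad one on, which the flip
    preserves; hence the flip is an involution. *)
Lemma bad_eq tau tau' :
  (forall k j, bad_column tau <= j -> unbalanced lam tau' k j = unbalanced lam tau k j) ->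
  ~~ yamanouchi tau ->
  [/\ ~~ yamanouchi tau', bad_column tau' = bad_column tau & bad_letter tau' = bad_letter tau].
Proof.
move=> e; rewrite negbK => hb.
have [h1 h2 h3] := find_iotaP (bad_at tau) N.+1.
set d := find _ _ in h1 h2 h3.
have dN : d < N.+1 by rewrite /d -{2}(size_iota 0 N.+1) -has_find.
have eb d' : d' <= d -> bad_at tau' d' = bad_at tau d'.
  move=> dd; apply: eq_has => k; apply: e; rewrite /bad_column -/d; lia.
have ed : find (bad_at tau') (iota 0 N.+1) = d.
  apply: find_iota_eq => // [t td|_]; first by rewrite eb ?h2 // ltnW.
  by rewrite eb ?h3.
have ec : bad_column tau' = bad_column tau by rewrite /bad_column ed.
split=> //; last by rewrite /bad_letter ec; apply: eq_find => k; apply: e.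
by rewrite negbK has_find ed size_iota.
Qed.

Let ssyts_pat T (h : T \in ssyts m sh) := (ssyts_pattern le_mu_lam mu_dec lam_dec h).1.

Definition yam_tab T := yamanouchi (pattern_of mu T).

Definition flip T :=
  bk_tableau lam mu m (bad_letter (pattern_of mu T)) (bad_column (pattern_of mu T)) T.

Lemma flipP T : T \in ssyts m sh -> ~~ yam_tab T ->
  [/\ flip T \in ssyts m sh, ~~ yam_tab (flip T), flip (flip T) = T &
    alternant (delta m + weight m (flip T))%MM = (- alternant (delta m + weight m T)%MM)%R].
Proof.
move=> hT nT; have p := ssyts_pat hT.
set tau := pattern_of mu T in p; have [km ub nub] := bad_spec p nT.
rewrite -/tau in km ub nub.
set k := bad_letter tau in km ub nub; set j := bad_column tau in ub nub.
have eflip : flip T = bk_tableau lam mu m k j T by [].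
have [h1 h2 h3] := bk_tableauP le_mu_lam mu_dec lam_dec j km hT.
have [hd colj] := unbalanced_column p ub nub.
have [n1 c1 l1] : [/\ ~~ yam_tab (flip T), bad_column (pattern_of mu (flip T)) = j
    & bad_letter (pattern_of mu (flip T)) = k].
  apply: (@bad_eq tau) => // k' j' jj; rewrite /unbalanced.
  by rewrite !(colsum_eq _ _ h3) !(bk_colsum k p).
split; [by rewrite eflip | exact: n1 | by rewrite {1}/flip c1 l1 eflip | ].
have k0m : k < m by lia.
pose k0 := Ordinal k0m; pose k1 := Ordinal km.
have := @bk_weight_tperm lam mu le_mu_lam mu_dec lam_dec m k j T k0 k1 1 erefl erefl hT colj.
rewrite addn1 => /(_ hd) [w0 [w1 wo]].
rewrite -(@alternant_tperm m k0 k1); last by rewrite -(inj_eq val_inj) /=; lia.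
have eD w i : (delta m + w)%MM i = m - i.+1 + w i by rewrite mnmDE [delta m i]mnmE.
(* [delta] drops by one from [k] to [k + 1], which absorbs the excess 1: the full exponent is
   exactly transposed. *)
congr alternant; apply/mnmP => i; rewrite [mnm_perm _ _ i]mnmE !eD eflip.
case: tpermP => [->|->|n0 n1']; last by rewrite wo //; apply/eqP.
  by move: w0; rewrite /=; lia.
by rewrite w1 /=; lia.
Qed.

Lemma alternant_skew :
  (alternant (delta m) * skew_mpoly m sh
   = \sum_(T <- ssyts m sh | yam_tab T) alternant (delta m + weight m T)%MM)%R.
Proof.
have -> : (alternant (delta m) * skew_mpoly m sh
    = \sum_(T <- ssyts m sh) alternant (delta m + weight m T)%MM)%R.
  rewrite /alternant mulr_suml exchange_big /=; apply: eq_bigr => s _.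
  rewrite -scaler_sumr -scalerAl; congr (_ *: _)%R.
  (* By symmetry [s] may act on the weights too, and then acts on [delta] plus weight. *)
  rewrite /skew_mpoly -(ssyts_perm le_mu_lam mu_dec lam_dec s (fun w => 'X_[w])%R).
  by rewrite mulr_sumr; apply: eq_bigr => T _; rewrite mnm_permD mpolyXD.
rewrite (bigID yam_tab) /=; set B := (X in (_ + X)%R).
suff -> : B = 0%R by rewrite addr0.
have eB : B = (- B)%R.
  rewrite /B -sumrN -[LHS]big_filter -[RHS]big_filter.
  apply: (@big_seq_bij _ _ _ _ _ flip flip); try exact/filter_uniq/uniq_ssyts.
    move=> T; rewrite mem_filter => /andP[nT hT]; have [h1 h2 h3 h4] := flipP hT nT.
    by split; [rewrite mem_filter h2 h1 | exact: h3 | rewrite h4 opprK].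
  move=> T; rewrite mem_filter => /andP[nT hT]; have [h1 h2 h3 h4] := flipP hT nT.
  by rewrite mem_filter h2 h1.
have : ((2%:R : rat) *: B = 0)%R by rewrite scaler_nat mulr2n {1}eB addNr.
by move/eqP; rewrite scaler_eq0 => /orP[|/eqP].
Qed.

End Cancellation.

(** Row [i] of a Yamanouchi tableau has only letters [<= i], by induction on the rows from the
    top. *)
Lemma yamanouchi_letters lam mu m tau : pattern lam mu m tau ->
  (forall k j, ~~ unbalanced lam tau k j) ->
  forall i k, i < size lam -> i < k -> tau k i = nth 0 lam i.
Proof.
move=> p bal; have [_ tm tS tI] := p.
have tdec k i i' : i <= i' -> i' < size lam -> tau k i' <= tau k i.
  move=> + i'L; elim: i' i'L => [|i' IH] i'L; first by rewrite leqn0 => /eqP->.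
  rewrite leq_eqVlt => /predU1P[->//|ii]; apply: leq_trans (IH (ltnW i'L) ii).
  exact: leq_trans (tS _ _ i'L) (tI _ _ i'L).
have step i : i < size lam -> (forall i' k, i' < i -> i' < k -> tau k i' = nth 0 lam i') ->
    forall k, i <= k -> tau k.+2 i <= tau k.+1 i.
  move=> iL IH k ik; rewrite leqNgt; apply/negP => lt_t.
  (* Test the first column where row [i] has [k + 1]: from there on, the rows above have no letter
     [k] by induction, and from row [i] down the letters [<= k] lie further left. *)
  have /negP := bal k (tau k.+1 i); apply; rewrite /unbalanced /colsum.
  have e1 : \sum_(0 <= i' < size lam) (tau k.+1 i' - tau k.+1 i)
      = \sum_(0 <= i' < size lam) (tau k i' - tau k.+1 i).
    rewrite !big_nat; apply: eq_bigr => i' /= i'L; have [ii|ii] := ltnP i' i.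
      have ik' := leq_trans ii ik.
      by rewrite (IH _ _ ii ik') (IH _ _ ii (leqW ik')).
    by have := tdec k.+1 _ _ ii i'L; have := tS k i' i'L; lia.
  rewrite -addnn -e1 ltn_add2r !big_mkord (bigD1 (Ordinal iL)) //=.
  rewrite [X in _ < X](bigD1 (Ordinal iL)) //= subnn add0n.
  rewrite -add1n; apply: leq_add; first by rewrite subn_gt0.
  by apply: leq_sum => i' _; apply: leq_sub2r; apply: tS.
move=> i; have [n] := ubnP i; elim: n i => // n IHn i /ltnSE le_in k iL ik.
have st : forall k, i <= k -> tau k.+2 i <= tau k.+1 i.
  by apply: step => // i' k' i'i; apply: IHn; [apply: leq_trans le_in|apply: ltn_trans iL].
have up d : tau (k + d) i <= tau k i.
  elim: d => [|d IHd]; first by rewrite addn0.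
  apply: leq_trans IHd; rewrite addnS.
  by case: (k + d) (leq_trans ik (leq_addr d k)) => // k' ik'; apply: st.
apply/eqP; rewrite eqn_leq (pattern_le_lam k p iL) /=.
by rewrite -(tm (k + m) i) ?leq_addl.
Qed.

(** * Straight shapes and the bialternant formula *)

Section Straight.
Variables (nu : seq nat) (m : nat).
Hypothesis nu_part : is_partition nu.
Hypothesis size_nu : size nu <= m.
Let mu := nseq (size nu) 0.

Let mu0 i : nth 0 mu i = 0. Proof. by rewrite nth_nseq if_same. Qed.

Let nu_dec i : nth 0 nu i.+1 <= nth 0 nu i.
Proof.
have [iL|Li] := ltnP i.+1 (size nu); last by rewrite nth_default.
case/andP: nu_part => /(sortedP 0) /(_ _ iL) //.
Qed.

Let superstandard k i := if i < k then nth 0 nu i else 0.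

Let pat0 : pattern nu mu m superstandard.
Proof.
split=> [i iL|k i mk iL|k i iL|k i iL]; rewrite /superstandard ?mu0 //.
- by rewrite (leq_trans iL) // (leq_trans size_nu).
- by have [ik|] := ltnP i k; first rewrite leqW.
by rewrite ltnS; case: (i < k).
Qed.

Let colsumS k' j :
  colsum nu superstandard k'.+1 j = colsum nu superstandard k' j + (nth 0 nu k' - j).
Proof.
rewrite /colsum; have [kL|Lk] := ltnP k' (size nu).
  rewrite !big_mkord (bigD1 (Ordinal kL)) //= [in RHS](bigD1 (Ordinal kL)) //=.
  rewrite /superstandard ltnSn ltnn sub0n add0n addnC; congr (_ + _); apply: eq_bigr => i.
  by rewrite -(inj_eq val_inj) /= => ik; rewrite ltnS leq_eqVlt (negbTE ik).
rewrite nth_default // sub0n addn0 !big_nat; apply: eq_bigr => i /= iL.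
by rewrite /superstandard (leq_trans iL Lk) ltnS (leq_trans (ltnW iL)).
Qed.

Let bal0 k j : ~~ unbalanced nu superstandard k j.
Proof. by rewrite /unbalanced !colsumS; have := nu_dec k; lia. Qed.

Let yam_unique tau : pattern nu mu m tau -> (forall k j, ~~ unbalanced nu tau k j) ->
  forall k i, i < size nu -> tau k i = superstandard k i.
Proof.
move=> p bal k i iL; rewrite /superstandard; case: ltnP => ki.
  exact: yamanouchi_letters p bal i k iL ki.
have [t0 _ _ tI] := p; elim: k i iL ki => [|k IH] i iL ki; first by rewrite t0.
by case: i iL ki => // i iL ki; apply/eqP; rewrite -leqn0 -(IH i) ?tI // ltnW.
Qed.

(** The only Yamanouchi tableau of partition shape has row [i] filled with the letter [i], so one
    alternant survives. *)
Lemma alternant_schur : (alternant (delta m) * skew_mpoly m (nu, mu)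
  = alternant (delta m + [multinom nth 0 nu i | i < m])%MM)%R.
Proof.
have h1 i : i < size nu -> nth 0 mu i <= nth 0 nu i by rewrite mu0.
have h2 i : i.+1 < size nu -> nth 0 mu i.+1 <= nth 0 mu i by rewrite !mu0.
have h3 i : i.+1 < size nu -> nth 0 nu i.+1 <= nth 0 nu i by rewrite nu_dec.
rewrite (alternant_skew h1 h2 h3).
pose T0 := tableau_of nu m superstandard.
have [T0s T0p] := pattern_ssyts pat0.
have e0 : pattern nu mu m (pattern_of mu T0) := (ssyts_pattern h1 h2 h3 T0s).1.
have T0y : yam_tab nu mu m T0.
  by apply/(yamanouchiP e0) => k j; rewrite /unbalanced !(colsum_eq _ _ T0p) bal0.
rewrite -big_filter (perm_big [:: T0]).
  rewrite big_seq1; congr alternant; congr mnm_add; apply/mnmP => k.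
  by rewrite (weightE k T0s) mnmE !(colsum_eq _ _ T0p) colsumS addKn subn0.
apply: uniq_perm => //; first exact/filter_uniq/uniq_ssyts.
move=> T; rewrite mem_filter inE; apply/andP/eqP => [[yT hT]|->//].
have [pT eT] := ssyts_pattern h1 h2 h3 hT.
rewrite -eT; apply: tableau_of_eq => k i iL; apply: yam_unique => // k' j'.
exact/(yamanouchiP pT).
Qed.
End Straight.

(** * Monomial coefficients and the number of variables *)

Definition exponent (al : seq nat) : 'X_{1..size al} := [multinom nth 0 al i | i < size al].

Lemma skew_schur_coef sh al :
  skew_schur sh al = ((skew_mpoly (size al) sh)@_(exponent al))%R.
Proof.
rewrite /skew_mpoly raddf_sum /= /ssyts big_filter /skew_schur -sum1_count natr_sum /=.
rewrite big_mkcondr /=; apply: eq_bigr => T _; rewrite mcoeffX.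
have -> : (content (size al) T == al) = (weight (size al) T == exponent al).
  apply/eqP/eqP => [e|/mnmP e].
    apply/mnmP => i; have := congr1 (fun s => nth 0 s i) e.
    by rewrite (nth_map 0) ?size_iota ?nth_iota // !mnmE.
  apply: (@eq_from_nth _ 0); first by rewrite size_map size_iota.
  move=> i; rewrite size_map size_iota => im.
  by have := e (Ordinal im); rewrite !mnmE (nth_map 0) ?size_iota ?nth_iota.
by case: (weight _ _ == _).
Qed.

Lemma skew_schur_pad sh al n : skew_schur sh (al ++ nseq n 0) = skew_schur sh al.
Proof.
rewrite /skew_schur -!size_filter; congr (_%:R)%R; apply: perm_size.
apply: uniq_perm; try exact/filter_uniq/uniq_fillings.
move=> T; rewrite !mem_filter !mem_fillings size_cat size_nseq.
set z := all _ (iota 0 (size (row_lengths sh))).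
rewrite /content iotaD map_cat eqseq_cat ?size_map ?size_iota //= add0n.
case: (is_ssyt sh T) => //=; case: eqP => //= _; case: (size T == _); rewrite ?andbF //=.
case: z; rewrite ?andbF //=.
set c := [seq _ | k <- iota (size al) n].
have ec : (c == nseq n 0) = all (fun k => count_mem k (flatten T) == 0) (iota (size al) n).
  rewrite -[RHS](all_map _ (pred1 0)) -/c.
  have -> : n = size c by rewrite size_map size_iota.
  exact/eqP/all_pred1P.
rewrite ec; apply/andP/idP => [[/allP h hT]|hT].
  apply/allP => r rT; apply/allP => x xr.
  have xm : x < size al + n by have /allP /(_ _ rT) /allP /(_ _ xr) := hT.
  rewrite ltnNge; apply/negP => ax; have := h x; rewrite mem_iota ax xm => /(_ isT).
  rewrite -leqn0 leqNgt -has_count has_pred1 => /negP; apply.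
  by apply/flattenP; exists r.
split.
  apply/allP => k; rewrite mem_iota => /andP[ak _].
  rewrite -leqn0 leqNgt -has_count has_pred1; apply/negP => /flattenP[r rT kr].
  have /allP /(_ _ rT) /allP /(_ _ kr) := hT; lia.
by apply/allP => r rT; apply/allP => x xr; have /allP /(_ _ rT) /allP /(_ _ xr) := hT; lia.
Qed.

(** The zeros of a decreasing sequence stand at its end, where [nth] returns 0 anyway. *)
Lemma nth_filter_pos c i : sorted geq c -> nth 0 [seq x <- c | 0 < x] i = nth 0 c i.
Proof.
elim: c i => [|x c IH] i //= pc; have sc := path_sorted pc.
case: posnP => [x0|x0]; last by case: i => //= i; rewrite IH.
have c0 : all (pred1 0) c.
  have := order_path_min (fun a b c ab bc => leq_trans bc ab) pc.
  by apply: sub_all => y /=; rewrite x0 leqn0.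
rewrite (eq_in_filter (a2 := pred0)) ?filter_pred0.
  rewrite nth_nil; case: i => [|i] //=; have [ic|ci] := ltnP i (size c); last by rewrite nth_default.
  by rewrite (eqP (allP c0 _ (mem_nth 0 ic))).
by move=> y yc /=; rewrite (eqP (allP c0 _ yc)).
Qed.

(** * The Schur expansion of a skew Schur function *)

Section LittlewoodRichardson.
Variables (lam mu : seq nat).
Let L := size lam.
Let sh := (lam, mu).

Hypothesis le_mu_lam : forall i, i < L -> nth 0 mu i <= nth 0 lam i.
Hypothesis mu_dec : forall i, i.+1 < L -> nth 0 mu i.+1 <= nth 0 mu i.
Hypothesis lam_dec : forall i, i.+1 < L -> nth 0 lam i.+1 <= nth 0 lam i.

Definition content_partition (T : seq (seq nat)) : seq nat := [seq x <- content L T | 0 < x].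

Definition yam_tabs m := [seq T <- ssyts m sh | yam_tab lam mu m T].

Let yam_tabsP m T : T \in yam_tabs m ->
  [/\ T \in ssyts m sh, pattern lam mu m (pattern_of mu T) &
      forall k j, ~~ unbalanced lam (pattern_of mu T) k j].
Proof.
rewrite mem_filter => /andP[yT hT]; have p := (ssyts_pattern le_mu_lam mu_dec lam_dec hT).1.
by split=> //; apply/(yamanouchiP p).
Qed.

Lemma yam_letters m T k : T \in yam_tabs m -> L <= k -> count_mem k (flatten T) = 0.
Proof.
move=> /yam_tabsP[hT p bal] Lk; have := count_colsum k hT.
have -> : colsum lam (pattern_of mu T) k.+1 0 = colsum lam (pattern_of mu T) k 0; last by lia.
rewrite /colsum !big_nat; apply: eq_bigr => i /= iL.
have ik := leq_trans iL Lk.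
by rewrite !(yamanouchi_letters p bal) // leqW.
Qed.

Lemma yam_count_dec m T k : T \in yam_tabs m ->
  count_mem k.+1 (flatten T) <= count_mem k (flatten T).
Proof.
move=> /yam_tabsP[hT p bal]; have := bal k 0; rewrite /unbalanced -leqNgt.
have := count_colsum k hT; have := count_colsum k.+1 hT; lia.
Qed.

Lemma nth_content_partition m T k : T \in yam_tabs m ->
  nth 0 (content_partition T) k = count_mem k (flatten T).
Proof.
move=> yT; rewrite nth_filter_pos.
  have [kL|Lk] := ltnP k L; first by rewrite (nth_map 0) ?size_iota ?nth_iota.
  by rewrite nth_default ?(yam_letters yT) // size_map size_iota.
apply/(sortedP 0) => i; rewrite size_map size_iota => iL.
have iL' := ltnW iL.
rewrite !(nth_map 0) ?size_iota // !nth_iota // !add0n; exact: yam_count_dec yT.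
Qed.

Lemma content_partitionP m T : T \in yam_tabs m -> is_partition (content_partition T).
Proof.
move=> yT; apply/andP; split; last by apply/allP => x; rewrite mem_filter => /andP[].
by apply/(sortedP 0) => i _; rewrite !(nth_content_partition _ yT); apply: yam_count_dec yT.
Qed.

(** Yamanouchi tableaux use only letters [< L]; this makes the Schur coefficients independent of the
    number of variables. *)
Lemma perm_yam_tabs m : L <= m -> perm_eq (yam_tabs m) (yam_tabs L).
Proof.
move=> Lm; apply: uniq_perm; try exact/filter_uniq/uniq_ssyts.
move=> T; apply/idP/idP => yT; have [hT p bal] := yam_tabsP yT; rewrite mem_filter.
  have hT' : T \in ssyts L sh.
    move: hT; rewrite !mem_ssyts => /and5P[-> _ -> -> ->]; rewrite !andbT /=.
    apply/allP => r rT; apply/allP => x xr; rewrite ltnNge; apply/negP => Lx.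
    have := yam_letters yT Lx; apply/eqP; rewrite -lt0n -has_count has_pred1.
    by apply/flattenP; exists r.
  have p' := (ssyts_pattern le_mu_lam mu_dec lam_dec hT').1.
  by rewrite hT' andbT; apply/(yamanouchiP p').
have hT' : T \in ssyts m sh.
  move: hT; rewrite !mem_ssyts => /and5P[-> h -> -> ->]; rewrite !andbT /=.
  by apply: sub_all h => r; apply: sub_all => x xL; apply: leq_trans Lm.
have p' := (ssyts_pattern le_mu_lam mu_dec lam_dec hT').1.
by rewrite hT' andbT; apply/(yamanouchiP p').
Qed.

Lemma skew_mpoly_schur m : L <= m ->
  (skew_mpoly m sh = \sum_(T <- yam_tabs L)
     skew_mpoly m (content_partition T, nseq (size (content_partition T)) 0%N))%R.
Proof.
move=> Lm; apply: (mulfI (alternant_delta_neq0 m)).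
rewrite alternant_skew // mulr_sumr.
transitivity (\sum_(T <- yam_tabs m) alternant (delta m)
    * skew_mpoly m (content_partition T, nseq (size (content_partition T)) 0%N))%R; last first.
  exact: perm_big (perm_yam_tabs Lm).
rewrite -big_filter -/(yam_tabs m) big_seq [RHS]big_seq.
apply: eq_bigr => T yT; rewrite alternant_schur ?(content_partitionP yT) //.
  congr alternant; congr mnm_add; apply/mnmP => k; rewrite !mnmE.
  by rewrite (nth_content_partition _ yT).
by apply: leq_trans Lm; rewrite size_filter (leq_trans (count_size _ _)) // size_map size_iota.
Qed.

Theorem skew_schur_positive : schur_positive (skew_schur sh).
Proof.
exists [seq (content_partition T, 1%R) | T <- yam_tabs L]; split.
  by apply/allP => p /mapP[T yT ->] /=; rewrite (content_partitionP yT).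
(* Padding with zero exponents reduces to at least [L] variables. *)
suff big al : L <= size al ->
    skew_schur sh al = (\sum_(T <- yam_tabs L) schur (content_partition T) al)%R.
  move=> al; rewrite -(skew_schur_pad sh al L) big ?size_cat ?size_nseq ?leq_addl //.
  rewrite big_map; apply: eq_bigr => T _; rewrite mul1r.
  exact: skew_schur_pad.
move=> Lal; rewrite skew_schur_coef (skew_mpoly_schur Lal) raddf_sum /=.
by apply: eq_bigr => T _; rewrite /schur skew_schur_coef.
Qed.
End LittlewoodRichardson.

(** * The theorem *)

Fixpoint linked (x : seq nat) (be : seq nat) (T : seq (seq nat)) : bool :=
  match T, be with
  | r :: T', b :: be' => ov b x r && linked r be' T'
  | _, _ => true
  end.

Lemma linked_nth x be T : size be = size T ->
  linked x be T = all (fun i => ov (nth 0 be i) (nth [::] (x :: T) i) (nth [::] T i)) (iota 0 (size T)).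
Proof.
elim: T x be => [|r T IH] x [|b be] //= [sz].
by rewrite IH // -[1]/(1 + 0) iotaDl all_map.
Qed.

Lemma tails_fillings (R : comNzRingType) m (X : nat -> R) x be al : size be = size al ->
  tails m X x be al = (\sum_(T <- fillings m al | all (sorted leq) T && linked x be T)
    wt X (flatten T))%R.
Proof.
elim: al x be => [|l al IH] x [|b be] //= => [_|[sz]].
  by rewrite big_cons big_nil /= /wt big_nil addr0.
rewrite [RHS]big_mkcond big_allpairs_dep /= big_filter_cond big_mkcond /=.
apply: eq_bigr => r _; rewrite -big_mkcond /= IH //.
have [sr|] := boolP (sorted leq r); last by rewrite big_pred0.
have [o|] := boolP (ov b x r); last by rewrite big_pred0 // => T; rewrite andbF.
by rewrite big_distrr /=; apply: eq_bigr => T _; rewrite wt_cat.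
Qed.

Section OverlapShape.
Variables (al be : seq nat).
Hypothesis val : valid_shape al be.
Let L := size al.

Let size_be : size be = L.-1.
Proof.
by move: val; rewrite /L; case: al => // l al'; rewrite valid_shape_nth // => /andP[/eqP].
Qed.

Let be_le i : i.+1 < L -> nth 0 be i <= nth 0 al i /\ nth 0 be i <= nth 0 al i.+1.
Proof.
move=> iL; have L0 : 0 < size al by apply: leq_ltn_trans iL.
move: val; rewrite valid_shape_nth // => /andP[_ /allP /(_ i)].
by rewrite mem_iota add0n ltn_predRL => /(_ iL); rewrite leq_min => /andP.
Qed.

Let ov_muS i : i.+1 < L -> ov_mu al be i = ov_mu al be i.+1 + (nth 0 al i.+1 - nth 0 be i).
Proof.
move=> iL; rewrite /ov_mu (_ : size al - i.+1 = (size al - i.+2).+1) /=; first by rewrite addnC.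
by rewrite -subSn.
Qed.

Let nth_mu i : i < L -> nth 0 (overlap_shape al be).2 i = ov_mu al be i.
Proof. by move=> iL; rewrite nth_mkseq. Qed.
Let nth_lam i : i < L -> nth 0 (overlap_shape al be).1 i = ov_mu al be i + nth 0 al i.
Proof. by move=> iL; rewrite nth_mkseq. Qed.

Lemma ov_schur_positive : schur_positive (ov_schur al be).
Proof.
apply: skew_schur_positive; rewrite size_mkseq => i iL.
- by rewrite nth_mu // nth_lam // leq_addr.
- by rewrite !nth_mu ?(ltnW iL) // (ov_muS iL) leq_addr.
rewrite !nth_lam ?(ltnW iL) // (ov_muS iL); have := be_le iL; lia.
Qed.

Lemma row_lengths_overlap : row_lengths (overlap_shape al be) = al.
Proof.
apply: (@eq_from_nth _ 0); rewrite /row_lengths size_map size_iota size_mkseq // => i iL.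
by rewrite (nth_map 0) ?size_iota // nth_iota // add0n nth_mu // nth_lam // addKn.
Qed.

Lemma is_ssyt_overlap m T : T \in fillings m al ->
  is_ssyt (overlap_shape al be) T = all (sorted leq) T && linked [::] (0 :: be) T.
Proof.
rewrite mem_fillings => /and3P[/eqP sT /allP zT _].
have L0 : 0 < L by move: val; rewrite /L; case: (al).
have szT i : i < L -> size (nth [::] T i) = nth 0 al i.
  by move=> iL; apply/eqP/zT; rewrite mem_iota.
have -> : linked [::] (0 :: be) T = linked (nth [::] T 0) be (behead T).
  by case: T sT {zT szT} => [|r T] //= e; move: L0; rewrite /L -e.
rewrite /is_ssyt size_mkseq sT eqxx /=.
have -> : all (fun i => size (nth [::] T i)
    == nth 0 (mkseq (ov_lam al be) (size al)) i - nth 0 (mkseq (ov_mu al be) (size al)) i)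
    (iota 0 (size al)).
  apply/allP => i; rewrite mem_iota => /= iL.
  by rewrite !nth_mkseq // /ov_lam addKn szT.
rewrite /=; congr (_ && _).
rewrite linked_nth ?size_behead ?sT ?size_be //.
apply: eq_in_all => i; rewrite mem_iota add0n ltn_predRL => /= iL.
have iL' := ltnW iL; have [b1 b2] := be_le iL.
have -> : nth [::] (nth [::] T 0 :: behead T) i = nth [::] T i.
  by case: T sT {zT szT} => [|r T] //= e; move: L0; rewrite /L -e.
rewrite nth_behead !nth_mkseq // /ov_lam (ov_muS iL).
apply/allP/ovP => [h t tb|h j _].
  have := h (ov_mu al be i.+1 + (nth 0 al i.+1 - nth 0 be i) + t).
  rewrite mem_iota add0n szT //.
  rewrite (_ : _ + t - (_ + _) = t); last lia.
  rewrite (_ : _ + t - ov_mu al be i.+1 = nth 0 al i.+1 - nth 0 be i + t); last lia.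
  move=> /(_ ltac:(lia)) /implyP; apply; lia.
apply/implyP => hj.
(* The position of column [j] within row [i], whose first column is the subtracted sum. *)
pose t := j - (ov_mu al be i.+1 + (nth 0 al i.+1 - nth 0 be i)).
have := h t; rewrite szT // /t => /(_ ltac:(lia)).
by rewrite (_ : _ + (j - _) = j - ov_mu al be i.+1); last lia.
Qed.

(** The value 0 at letters [>= m] is a mere default; they do not occur in the fillings. *)
Definition letter_var (m c : nat) : {mpoly rat[m]} :=
  (if insub c is Some i then 'X_(i : 'I_m) else 0)%R.

Lemma wt_letter_var m r : all (fun x => x < m) r ->
  wt (letter_var m) r = 'X_[[multinom count_mem (k : nat) r | k < m]]%R.
Proof.
rewrite /wt; elim: r => [|c r IH] /= => [_|/andP[cm ar]].
  by rewrite big_nil -mpolyX0; congr mpolyX; apply/mnmP => i; rewrite mnm0E mnmE.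
rewrite big_cons IH // /letter_var insubT -mpolyXD; congr mpolyX; apply/mnmP => i.
by rewrite mnmDE mnm1E !mnmE -(inj_eq val_inj).
Qed.

Lemma chain_gf_skew_mpoly m : chain_gf m (letter_var m) al be = skew_mpoly m (overlap_shape al be).
Proof.
have L0 : 0 < L by move: val; rewrite /L; case: (al).
rewrite /chain_gf tails_fillings /=; last by rewrite size_be prednK.
rewrite /skew_mpoly /ssyts row_lengths_overlap big_filter.
rewrite [LHS]big_seq_cond [RHS]big_seq_cond; apply: eq_big => T.
  by case hT: (T \in _) => //=; rewrite (is_ssyt_overlap hT).
rewrite mem_fillings => /andP[/and3P[_ _ aT] _]; rewrite wt_letter_var //.
by apply/allP => x /flattenP[r rT xr]; apply: (allP (allP aT _ rT)).
Qed.

Lemma ov_schur_coef x :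
  ov_schur al be x = ((chain_gf (size x) (letter_var (size x)) al be)@_(exponent x))%R.
Proof. by rewrite chain_gf_skew_mpoly -skew_schur_coef. Qed.
End OverlapShape.

Lemma schur_positive_sum (l : seq (seq nat * seq nat)) :
  all (fun p => valid_shape p.1 p.2) l ->
  schur_positive (fun x => \sum_(p <- l) ov_schur p.1 p.2 x)%R.
Proof.
elim: l => [|p l IH] /= => [_|/andP[vp /IH[cs [hcs ecs]]]].
  by exists [::]; split=> // x; rewrite !big_nil.
have [cs' [hcs' ecs']] := ov_schur_positive vp.
exists (cs' ++ cs); split=> [|x]; first by rewrite all_cat hcs'.
by rewrite big_cons big_cat /= ecs' ecs.
Qed.

(** The identity is specialised to as many variables as [x] has entries; as the list of shapes is
    the same each time, one Schur expansion serves all [x]. *)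
Lemma schur_positive_sub al be al' be' : valid_shape al be -> valid_shape al' be' ->
  skew_sum (fun R m X => chain_gf m X al be - chain_gf m X al' be')%R ->
  schur_positive (fun x => ov_schur al be x - ov_schur al' be' x)%R.
Proof.
move=> v v' [l vl e]; have [cs [hcs ecs]] := schur_positive_sum vl.
exists cs; split=> // x; rewrite -ecs !ov_schur_coef // -raddfB /= e raddf_sum /=.
by rewrite !big_seq; apply: eq_bigr => p pl; rewrite ov_schur_coef // (allP vl).
Qed.

Theorem theorem3p1 (sigma tau sb tb : seq nat) :
  standing_hyp sigma tau sb tb ->
  (forall a b : nat, 2 <= b -> b <= a ->
     schur_positive (fun x =>
       (ov_schur (sigma ++ [:: a; b] ++ tau) (sb ++ [:: 1%N] ++ tb) x -
        ov_schur (sigma ++ [:: a.+1; b.-1] ++ tau) (sb ++ [:: 1%N] ++ tb) x)%R)) /\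
  (forall a n : nat, 2 <= a -> 2 <= n ->
     schur_positive (fun x =>
       (ov_schur (sigma ++ nseq n a ++ tau) (sb ++ nseq n.-1 1%N ++ tb) x -
        ov_schur (sigma ++ [:: a.+1] ++ nseq (n - 2) a ++ [:: a.-1] ++ tau)
                 (sb ++ nseq n.-1 1%N ++ tb) x)%R)).
Proof.
move=> hyp; have [szS _ vS] := standing_left_ctx hyp; have [_ vT] := standing_right_ctx hyp.
have vT' k a u : 0 < a -> 0 < u -> valid_shape (u :: nseq k a ++ tau) (nseq k 1 ++ tb).
  move=> a0; elim: k u => [|k IH] u u0; first exact: vT.
  by have /= -> := IH _ a0; rewrite leq_min u0 a0.
split=> [a b b2 ba|a n a2 n2].
  apply: schur_positive_sub (skew_sum_two_rows hyp b2 ba);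
    rewrite valid_shape_cat // vS //=; try lia.
    by have /= -> := vT b ltac:(lia); lia.
  by have /= -> := vT b.-1 ltac:(lia); lia.
apply: schur_positive_sub (skew_sum_equal_rows hyp a2 n2).
  case: n n2 => // n n2; rewrite /= valid_shape_cat // vS ?vT' //; lia.
case: n n2 => [|[|n]] // _; rewrite !subSS subn0 /= valid_shape_cat // vS //=.
have -> : nseq n a ++ a.-1 :: tau = nseq n a ++ [:: a.-1] ++ tau by [].
(* Stated for any top row [u], so that the induction can run down the rows [a]. *)
have h : forall u, 0 < u -> valid_from u (nseq n a ++ a.-1 :: tau) (nseq n.+1 1 ++ tb).
  elim: n => [|n IH] u u0 /=; first by have /= -> := vT a.-1 ltac:(lia); lia.
  by rewrite IH; lia.
exact: h.
Qed.
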